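(* Let $k$ be a field, $Q$ an affine semigroup, $R=k[Q]$, and $I\subseteq R$ a graded ideal. If $M$ is a finitely generated $Q^{\rm gp}$-graded $R$-module, then for every $i$ the $R$-module $H^i_I(M)_Q$ is finitely generated.
   Context: An affine semigroup is a finitely generated submonoid $Q\subseteq\mathbb Z^d$ with group generated $Q^{\rm gp}=\mathbb Z^d$; $R=k[Q]$ is graded by $Q$. $H^i_I$ is the $i$th right derived functor, on the category of $Q^{\rm gp}$-graded $R$-modules with degree-preserving maps, of $\Gamma_I$ (elements killed by some power of $I$). For a $Q^{\rm gp}$-graded module $N$, $N_Q=\bigoplus_{a\in Q}N_a$ is its $Q$-graded part, a submodule of $N$. *)

(* Defs.v *)
From HB Require Import structures.
From mathcomp Require Import all_boot all_order all_algebra.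
From mathcomp Require Import finmap boolp.
From mathcomp Require Import monalg.

Set Implicit Arguments.
Unset Strict Implicit.
Unset Printing Implicit Defensive.

Import GRing.Theory.
Local Open Scope ring_scope.

(* The library gives {malg K[A]} (finitely supported functions A -> K) a ring
   structure only when A is a monoid without nontrivial units; affine
   semigroups may have units, so the convolution product is defined here for
   an arbitrary commutative monoid A, written additively. *)
Definition monoid_algebra (K : comNzRingType) (A : nmodType) : Type :=
  {malg K[A]}.

Section MonoidAlgebra.
Variables (K : comNzRingType) (A : nmodType).
Local Notation T := (monoid_algebra K A).

HB.instance Definition _ := GRing.Lmodule.copy T {malg K[A]}.

Definition ma_one : T := << 1 *g (0 : A) >>.

Definition ma_mul (f g : T) : T :=
  \sum_(a <- msupp f) \sum_(b <- msupp g) << f@_a * g@_b *g (a + b) >>.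

Lemma ma_mulw (s t : {fset A}) (f g : T) :
  (msupp f `<=` s)%fset -> (msupp g `<=` t)%fset ->
  ma_mul f g = \sum_(a <- s) \sum_(b <- t) << f@_a * g@_b *g (a + b) >>.
Proof.
move=> fs gt; rewrite /ma_mul (big_fset_incl _ fs) /=.
  apply/eq_bigr=> a _; apply/big_fset_incl => // b _ /mcoeff_outdom ->.
  by rewrite mulr0 monalgU0.
move=> a _ /mcoeff_outdom fa.
by rewrite big1 => // b _; rewrite fa mul0r monalgU0.
Qed.

Lemma ma_mulC : commutative ma_mul.
Proof.
move=> f g; rewrite /ma_mul exchange_big /=.
by apply/eq_bigr=> a _; apply/eq_bigr=> b _; rewrite mulrC addrC.
Qed.

Lemma ma_mulDl : left_distributive ma_mul +%R.
Proof.
move=> f1 f2 g.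
have le12 : (msupp (f1 + f2 : T) `<=` msupp f1 `|` msupp f2)%fset.
  exact: msuppD_le.
rewrite [in RHS](ma_mulw (fsubsetUl (msupp f1) (msupp f2)) (fsubset_refl _)).
rewrite [in RHS](ma_mulw (fsubsetUr (msupp f1) (msupp f2)) (fsubset_refl _)).
rewrite (ma_mulw le12 (fsubset_refl _)).
rewrite -big_split /=; apply/eq_bigr=> a _.
rewrite -big_split /=; apply/eq_bigr=> b _.
by rewrite mcoeffD mulrDl monalgUD.
Qed.

Lemma ma_mul0 : left_zero 0 ma_mul.
Proof. by move=> g; rewrite /ma_mul msupp0 big_seq_fset0. Qed.

Lemma ma_mulDr : right_distributive ma_mul +%R.
Proof. by move=> f g h; rewrite ma_mulC ma_mulDl !(ma_mulC f). Qed.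

Lemma ma_mulr0 : right_zero 0 ma_mul.
Proof. by move=> g; rewrite ma_mulC ma_mul0. Qed.

Lemma ma_mulUU (c e : K) (a b : A) :
  ma_mul << c *g a >> << e *g b >> = << c * e *g (a + b) >>.
Proof.
by rewrite (ma_mulw msuppU_le msuppU_le) !big_seq_fset1 !mcoeffUU.
Qed.

Lemma ma_mul_suml (J : Type) (s : seq J) (F : J -> T) (g : T) :
  ma_mul (\sum_(i <- s) F i) g = \sum_(i <- s) ma_mul (F i) g.
Proof.
exact: (big_morph (ma_mul^~ g) (fun _ _ => ma_mulDl _ _ _) (ma_mul0 _)).
Qed.

Lemma ma_mul_sumr (J : Type) (s : seq J) (F : J -> T) (g : T) :
  ma_mul g (\sum_(i <- s) F i) = \sum_(i <- s) ma_mul g (F i).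
Proof.
by rewrite ma_mulC ma_mul_suml; apply: eq_bigr => i _; rewrite ma_mulC.
Qed.

Lemma ma_mulA : associative ma_mul.
Proof.
have AUU c a e b (h : T) : ma_mul << c *g a >> (ma_mul << e *g b >> h) =
    ma_mul (ma_mul << c *g a >> << e *g b >>) h.
  rewrite [h]monalgE ma_mulUU [in RHS]ma_mul_sumr.
  rewrite [ma_mul << e *g b >> _]ma_mul_sumr [LHS]ma_mul_sumr; apply: eq_bigr => i _.
  by rewrite !ma_mulUU mulrA addrA.
have AU c a (g h : T) : ma_mul << c *g a >> (ma_mul g h) =
    ma_mul (ma_mul << c *g a >> g) h.
  rewrite [g]monalgE [ma_mul (\sum_(i <- _) _) h]ma_mul_suml [LHS]ma_mul_sumr.
  rewrite [ma_mul << c *g a >> (\sum_(i <- _) _)]ma_mul_sumr [RHS]ma_mul_suml.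
  by apply: eq_bigr => i _; rewrite AUU.
move=> f g h; rewrite [f]monalgE [LHS]ma_mul_suml.
rewrite [ma_mul (\sum_(i <- _) _) g]ma_mul_suml [RHS]ma_mul_suml.
by apply: eq_bigr => i _; rewrite AU.
Qed.

Lemma ma_mul1 : left_id ma_one ma_mul.
Proof.
move=> f; rewrite [f](monalgE f) ma_mul_sumr; apply: eq_bigr => a _.
by rewrite ma_mulUU mul1r add0r.
Qed.

Lemma ma_one_neq0 : ma_one != 0.
Proof.
apply/eqP => /(congr1 (mcoeff (0 : A))) /eqP.
by rewrite mcoeffUU mcoeff0 oner_eq0.
Qed.

HB.instance Definition _ := GRing.Zmodule_isComNzRing.Build T
  ma_mulA ma_mulC ma_mul1 ma_mulDl ma_one_neq0.

Lemma ma_scaleAl (c : K) (f g : T) : c *: (f * g) = (c *: f) * g.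
Proof.
have E (h : T) : c *: h = ma_mul << c *g 0 >> h.
  rewrite (ma_mulw msuppU_le (fsubset_refl _)) big_seq_fset1.
  rewrite -[LHS]/(fgscale c h); apply: eq_bigr => b _.
  by rewrite mcoeffUU add0r.
by rewrite !E; apply: ma_mulA.
Qed.

HB.instance Definition _ := GRing.Lmodule_isLalgebra.Build K T ma_scaleAl.
HB.instance Definition _ := GRing.Lalgebra_isComAlgebra.Build K T.

End MonoidAlgebra.

Record subset_of (T : choiceType) (S : {pred T}) := SubsetOf {
  so_val :> T;
  so_valP : so_val \in S }.

HB.instance Definition _ (T : choiceType) (S : {pred T}) :=
  [isSub for @so_val T S].
HB.instance Definition _ (T : choiceType) (S : {pred T}) :=
  [Choice of subset_of S by <:].
HB.instance Definition _ (V : nmodType) (Q : addrClosed V) :=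
  GRing.SubChoice_isSubNmodule.Build V _ (subset_of Q) (rpred0D Q).

(* As Q is a submonoid, the group it generates is its set of differences. *)
Definition affine_semigroup (d : nat) (Q : addrClosed 'rV[int]_d) : Prop :=
  (exists gens : seq 'rV[int]_d, {subset gens <= Q} /\
     forall a, a \in Q -> exists m : 'I_(size gens) -> nat,
       a = \sum_(i < size gens) gens`_i *+ m i) /\
  (forall a : 'rV[int]_d, exists b c, [/\ b \in Q, c \in Q & a = b - c]).

Definition semigroup_ring (k : fieldType) (d : nat) (Q : addrClosed 'rV[int]_d) :=
  monoid_algebra k (subset_of Q).

HB.instance Definition _ (k : fieldType) (d : nat) (Q : addrClosed 'rV[int]_d) :=
  GRing.ComAlgebra.copy (semigroup_ring k Q) (monoid_algebra k (subset_of Q)).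

Section Graded.
Variables (k : fieldType) (d : nat) (Q : addrClosed 'rV[int]_d).
Local Notation R := (semigroup_ring k Q).
Local Notation deg := 'rV[int]_d.

(* The graded piece of degree a of k[Q]; it is 0 when a is not in Q. *)
Definition homogeneous (a : deg) (r : R) : Prop :=
  forall q : subset_of Q, r@_q != 0 -> so_val q = a.

Lemma homogeneous0 a : homogeneous a 0.
Proof. by move=> q; rewrite mcoeff0 eqxx. Qed.

Lemma homogeneousB a r s :
  homogeneous a r -> homogeneous a s -> homogeneous a (r - s).
Proof.
move=> hr hs q; have -> : (r - s)@_q = r@_q - s@_q by exact: mcoeffB.
have [r0|r0 _] := eqVneq (r@_q) 0; last exact: hr.
by rewrite r0 sub0r oppr_eq0; apply: hs.
Qed.

Lemma homogeneousU (c : k) (q : subset_of Q) :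
  homogeneous (so_val q) (<< c *g q >> : R).
Proof.
by move=> q'; rewrite mcoeffU; case: (eqVneq q q') => [-> //|_]; rewrite eqxx.
Qed.

Lemma homogeneousM a b r s :
  homogeneous a r -> homogeneous b s -> homogeneous (a + b) (r * s).
Proof.
move=> hr hs q coef; apply/eqP; move: coef; apply: contraNT => qab; apply/eqP.
rewrite -[r * s]/(ma_mul r s) /ma_mul raddf_sum big_seq big1 //= => q1.
rewrite -mcoeff_neq0 => /hr q1a.
rewrite raddf_sum big_seq big1 //= => q2; rewrite -mcoeff_neq0 => /hs q2b.
rewrite mcoeffU; case: (eqVneq (q1 + q2) q) qab => [<-|//].
by rewrite -q1a -q2b eqxx.
Qed.

(* [gm_span] and [gm_indep] say that the module is the internal direct sum of
   its graded pieces. *)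
Record graded_module := GradedModule {
  gm_mod :> lmodType R;
  gm_comp : deg -> gm_mod -> Prop;
  gm_comp0 : forall a, gm_comp a 0;
  gm_compB : forall a x y, gm_comp a x -> gm_comp a y -> gm_comp a (x - y);
  gm_compZ : forall a b r x,
    homogeneous a r -> gm_comp b x -> gm_comp (a + b) (r *: x);
  gm_span : forall x, exists (s : seq deg) (f : deg -> gm_mod),
    (forall a, gm_comp a (f a)) /\ x = \sum_(a <- s) f a;
  gm_indep : forall (s : seq deg) (f : deg -> gm_mod),
    uniq s -> (forall a, gm_comp a (f a)) -> \sum_(a <- s) f a = 0 ->
    forall a, a \in s -> f a = 0 }.

Record graded_hom (M N : graded_module) := GradedHom {
  gh_fun :> {linear M -> N};
  gh_deg : forall a x, gm_comp a x -> gm_comp a (gh_fun x) }.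

Definition finitely_generated (M : lmodType R) : Prop :=
  exists (n : nat) (g : 'I_n -> M),
    forall x, exists c : 'I_n -> R, x = \sum_(i < n) c i *: g i.

Section HomogeneousSpan.
Variable M : graded_module.

Lemma gm_compN a (x : M) : gm_comp a x -> gm_comp a (- x).
Proof. by move=> hx; rewrite -sub0r; apply: gm_compB => //; apply: gm_comp0. Qed.

Lemma gm_compD a (x y : M) : gm_comp a x -> gm_comp a y -> gm_comp a (x + y).
Proof. by move=> hx hy; rewrite -[y]opprK; apply/gm_compB/gm_compN. Qed.

Definition hspan (P : M -> Prop) (x : M) : Prop :=
  exists (s : seq deg) (f : deg -> M),
    (forall a, gm_comp a (f a) /\ P (f a)) /\ x = \sum_(a <- s) f a.

Lemma sum_widen (s t : seq deg) (f : deg -> M) :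
  uniq s -> uniq t -> {subset s <= t} -> (forall a, a \notin s -> f a = 0) ->
  \sum_(a <- t) f a = \sum_(a <- s) f a.
Proof.
move=> us ut st f0; rewrite (bigID (mem s)) /= [X in _ + X]big1 => [|a /f0 //].
rewrite addr0 -big_filter; apply: perm_big; apply: uniq_perm => //.
  by rewrite filter_uniq.
by move=> a; rewrite mem_filter andb_idr // => /st.
Qed.

Section AddClosed.
Variable P : M -> Prop.
Hypotheses (P0 : P 0) (PD : forall x y, P x -> P y -> P (x + y)).

Lemma sum_undup (s : seq deg) (f : deg -> M) :
  (forall a, gm_comp a (f a) /\ P (f a)) ->
  exists g : deg -> M, [/\ forall a, gm_comp a (g a) /\ P (g a),
    forall a, a \notin s -> g a = 0 & \sum_(a <- s) f a = \sum_(a <- undup s) g a].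
Proof.
move=> hf; elim: s => [|b s [g [hg g0 e]]].
  exists (fun=> 0); rewrite !big_nil; split=> // a.
  by split=> //; apply: gm_comp0.
exists (fun a => g a + (if a == b then f b else 0)); split=> [a|a|].
- have [-> | _] := eqVneq a b; last by rewrite addr0.
  have [hgb Pgb] := hg b; have [hfb Pfb] := hf b.
  by split; [apply: gm_compD | apply: PD].
- by rewrite inE negb_or => /andP[/negbTE -> /g0 ->]; rewrite addr0.
rewrite big_cons e addrC big_split /=; congr (_ + _).
  case: ifP => // bs; rewrite big_cons g0 ?add0r //.
  by rewrite bs.
rewrite -big_mkcond -big_filter -[X in filter _ X]/(undup (b :: s)).
rewrite filter_pred1_uniq ?undup_uniq ?mem_undup ?mem_head //.
by rewrite big_seq1.
Qed.

Lemma hspan_uniq x : hspan P x -> exists (s : seq deg) (f : deg -> M),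
  [/\ uniq s, forall a, gm_comp a (f a) /\ P (f a),
      forall a, a \notin s -> f a = 0 & x = \sum_(a <- s) f a].
Proof.
move=> [s [f [hf ->]]]; have [g [hg g0 e]] := sum_undup s hf.
exists (undup s), g; split=> //; first exact: undup_uniq.
by move=> a; rewrite mem_undup; apply: g0.
Qed.

Lemma hspan0 : hspan P 0.
Proof.
exists [::], (fun=> 0); rewrite big_nil; split=> // a.
by split=> //; apply: gm_comp0.
Qed.

Lemma hspan_hom a x : gm_comp a x -> P x -> hspan P x.
Proof.
move=> hx Px; exists [:: a], (fun b => if b == a then x else 0).
rewrite big_seq1 eqxx; split=> // b.
by case: (eqVneq b a) => [->|_] //; split=> //; apply: gm_comp0.
Qed.

Lemma hspanD x y : hspan P x -> hspan P y -> hspan P (x + y).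
Proof.
move=> /hspan_uniq[s [f [us hf f0 ->]]] /hspan_uniq[t [g [ut hg g0 ->]]].
exists (undup (s ++ t)), (fun a => f a + g a); split=> [a|].
  have [hfa Pfa] := hf a; have [hga Pga] := hg a.
  by split; [apply: gm_compD | apply: PD].
rewrite big_split /=; congr (_ + _); apply/esym/sum_widen => //;
  by rewrite ?undup_uniq // => a; rewrite mem_undup mem_cat => ->; rewrite ?orbT.
Qed.

Lemma hspan_sum (J : eqType) (s : seq J) (F : J -> M) :
  (forall j, j \in s -> hspan P (F j)) -> hspan P (\sum_(j <- s) F j).
Proof.
elim: s => [|j s IHs] hF; first by rewrite big_nil; apply: hspan0.
rewrite big_cons; apply: hspanD; first exact/hF/mem_head.
by apply: IHs => i si; apply: hF; rewrite inE si orbT.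
Qed.

End AddClosed.

Lemma decomposition (x : M) : exists (s : seq deg) (f : deg -> M),
  [/\ uniq s, forall a, gm_comp a (f a), forall a, a \notin s -> f a = 0
     & x = \sum_(a <- s) f a].
Proof.
have [s [f [hf e]]] := gm_span x.
have [|||t [g [ut hg g0 e']]] := @hspan_uniq (fun=> True) _ _ x; rewrite //.
  by exists s, f; split=> // a; split.
by exists t, g; split=> // a; have [] := hg a.
Qed.

Lemma hspan_crit (P : M -> Prop) x : P 0 ->
    (forall s f, uniq s -> (forall a, gm_comp a (f a)) ->
      x = \sum_(a <- s) f a -> forall a, a \in s -> P (f a)) ->
  hspan P x.
Proof.
move=> P0 hP; have [s [f [us hf f0 e]]] := decomposition x.
exists s, f; split=> // a; split=> //.
by have [/(hP _ _ us hf e)//|/f0 ->] := boolP (a \in s).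
Qed.

End HomogeneousSpan.

Section Regular.

Lemma regular_span (r : R^o) : exists (s : seq deg) (f : deg -> R^o),
  (forall a, homogeneous a (f a)) /\ r = \sum_(a <- s) f a.
Proof.
exists [seq so_val q | q <- msupp r].
exists (fun a => odflt 0
  (omap (fun q : subset_of Q => << r@_q *g q >> : R) (insub a))).
split=> [a|].
  by case: insubP => [q _ <-|_] /=; [apply: homogeneousU | apply: homogeneous0].
rewrite big_map [LHS](monalgE (r : R)); apply: eq_bigr => q _.
by rewrite (valK q).
Qed.

Lemma regular_indep (s : seq deg) (f : deg -> R^o) :
  uniq s -> (forall a, homogeneous a (f a)) -> \sum_(a <- s) f a = 0 ->
  forall a, a \in s -> f a = 0.
Proof.
move=> us hf sum0 a sa; apply/(malgP (f a : {malg k[_]})) => q.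
rewrite mcoeff0; apply/eqP; apply: contraT => fq.
have qa := hf a q fq.
have := congr1 (mcoeff q) (sum0 : _ = 0 :> {malg k[_]}).
rewrite mcoeff0 raddf_sum (bigD1_seq a) //= big1 => [|b ba].
  by rewrite addr0 => e; rewrite e eqxx in fq.
by apply/eqP; apply: contraNT ba => fbq; rewrite -(hf b q fbq) qa.
Qed.

Definition regular_graded : graded_module :=
  @GradedModule R^o homogeneous homogeneous0 homogeneousB homogeneousM
    regular_span regular_indep.

End Regular.

Record graded_submodule (M : graded_module) := GradedSubmodule {
  gs_mem :> M -> Prop;
  gs0 : gs_mem 0;
  gsB : forall x y, gs_mem x -> gs_mem y -> gs_mem (x - y);
  gsZ : forall (r : R) x, gs_mem x -> gs_mem (r *: x);
  gs_span : forall x, gs_mem x -> hspan gs_mem x }.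

Local Notation graded_ideal := (graded_submodule regular_graded).

Section SubQuotient.
Variables (M : graded_module) (N : graded_submodule M).

Lemma gsN x : N x -> N (- x).
Proof. by move=> Nx; rewrite -sub0r; apply: gsB => //; apply: gs0. Qed.

Lemma gsD x y : N x -> N y -> N (x + y).
Proof. by move=> Nx Ny; rewrite -[y]opprK; apply/gsB/gsN. Qed.

Lemma gs_sum (J : eqType) (s : seq J) (F : J -> M) :
  (forall j, j \in s -> N (F j)) -> N (\sum_(j <- s) F j).
Proof.
move=> hF; rewrite big_seq; elim/big_rec: _ => [|j x /hF Nj Nx].
  exact: gs0.
exact: gsD.
Qed.

Lemma gs_homP (s : seq deg) (f : deg -> M) :
  uniq s -> (forall a, gm_comp a (f a)) -> N (\sum_(a <- s) f a) ->
  forall a, a \in s -> N (f a).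
Proof.
move=> us hf /gs_span /(hspan_uniq (gs0 N) gsD)[t [g [ut hg g0 e]]] a sa.
suff -> : f a = g a by have [] := hg a.
have e0 : \sum_(b <- undup (s ++ t)) ((if b \in s then f b else 0) - g b) = 0.
  rewrite sumrB; apply/eqP; rewrite subr_eq0; apply/eqP.
  transitivity (\sum_(b <- s) (if b \in s then f b else 0)).
    apply: sum_widen; rewrite ?undup_uniq // => b.
      by rewrite mem_undup mem_cat => ->.
    by move=> /negbTE ->.
  rewrite (eq_big_seq f) => [|b -> //].
  rewrite e; apply/esym/sum_widen; rewrite ?undup_uniq // => b.
  by rewrite mem_undup mem_cat orbC => ->.
have /= := gm_indep (undup_uniq (s ++ t)) _ e0.
move=> /(_ _ a); rewrite mem_undup mem_cat sa => h.
apply/eqP; rewrite -subr_eq0; apply/eqP; apply: h => // b.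
apply: gm_compB; last by have [] := hg b.
by case: ifP => // _; apply: gm_comp0.
Qed.

Definition gs_pred : {pred M} := fun x => `[< N x >].

Lemma gs_predP x : reflect (N x) (x \in gs_pred).
Proof. exact: asboolP. Qed.

Lemma gs_pred_zmod : zmod_closed gs_pred.
Proof.
split=> [|x y /gs_predP Nx /gs_predP Ny]; apply/gs_predP; first exact: gs0.
exact: gsB.
Qed.

Lemma gs_pred_scale : GRing.scaler_closed gs_pred.
Proof. by move=> r x /gs_predP Nx; apply/gs_predP/gsZ. Qed.

HB.instance Definition _ := GRing.isZmodClosed.Build M gs_pred gs_pred_zmod.
HB.instance Definition _ := GRing.isScaleClosed.Build R M gs_pred gs_pred_scale.

Definition sub_carrier : Type := subset_of gs_pred.
HB.instance Definition _ := SubChoice.on sub_carrier.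
HB.instance Definition _ :=
  GRing.SubChoice_isSubZmodule.Build M _ sub_carrier gs_pred_zmod.
HB.instance Definition _ :=
  GRing.SubZmodule_isSubLmodule.Build R M _ sub_carrier
    (submodClosedP gs_pred).

Definition sub_comp a (x : sub_carrier) : Prop := gm_comp a (val x).

Definition sub_elt x (Nx : N x) : sub_carrier :=
  SubsetOf (introT (gs_predP x) Nx).

Lemma sub_memP (x : sub_carrier) : N (val x).
Proof. exact/gs_predP/so_valP. Qed.

Lemma sub_span x : exists (s : seq deg) (f : deg -> sub_carrier),
  (forall a, sub_comp a (f a)) /\ x = \sum_(a <- s) f a.
Proof.
have [s [f [hf e]]] := gs_span (sub_memP x).
exists s, (fun a => sub_elt (hf a).2); split=> [a|]; first exact: (hf a).1.
by apply: val_inj; rewrite raddf_sum.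
Qed.

Lemma sub_indep (s : seq deg) (f : deg -> sub_carrier) :
  uniq s -> (forall a, sub_comp a (f a)) -> \sum_(a <- s) f a = 0 ->
  forall a, a \in s -> f a = 0.
Proof.
move=> us hf e a sa; apply: val_inj; rewrite raddf0.
apply: (gm_indep us (f := fun a => val (f a))) => //.
by rewrite -raddf_sum e raddf0.
Qed.

Lemma sub_comp0 a : sub_comp a 0.
Proof. by rewrite /sub_comp raddf0; apply: gm_comp0. Qed.

Lemma sub_compB a x y : sub_comp a x -> sub_comp a y -> sub_comp a (x - y).
Proof. by rewrite /sub_comp raddfB; apply: gm_compB. Qed.

Lemma sub_compZ a b (r : R) x :
  homogeneous a r -> sub_comp b x -> sub_comp (a + b) (r *: x).
Proof. by rewrite /sub_comp linearZ; apply: gm_compZ. Qed.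

Definition sub_graded : graded_module :=
  GradedModule sub_comp0 sub_compB sub_compZ sub_span sub_indep.

Definition quot_carrier : Type := Quotient.quot gs_pred.
HB.instance Definition _ := GRing.Zmodule.on quot_carrier.

Definition quot_pi (x : M) : quot_carrier := (\pi_(Quotient.quot gs_pred) x)%qT.

Lemma quot_piP x y : quot_pi x = quot_pi y <-> N (x - y).
Proof.
have e : (x - y \in gs_pred) = (quot_pi x == quot_pi y).
  exact: Quotient.idealrBE.
by rewrite (rwP (gs_predP (x - y))) e; split=> /eqP.
Qed.

Lemma quot_piK (u : quot_carrier) : quot_pi (repr u) = u.
Proof. exact: reprK. Qed.

Lemma quot_piB x y : quot_pi (x - y) = quot_pi x - quot_pi y.
Proof. exact: raddfB. Qed.

Definition quot_scale (r : R) (u : quot_carrier) : quot_carrier :=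
  quot_pi (r *: repr u).

Lemma quot_scaleE r x : quot_scale r (quot_pi x) = quot_pi (r *: x).
Proof.
apply/quot_piP; rewrite -scalerBr; apply: gsZ.
by apply/quot_piP; rewrite quot_piK.
Qed.

HB.instance Definition _ :=
  GRing.isZmodMorphism.Build M quot_carrier quot_pi quot_piB.

Lemma quot_scaleA (r s : R) u :
  quot_scale r (quot_scale s u) = quot_scale (r * s) u.
Proof. by rewrite -(quot_piK u) !quot_scaleE scalerA. Qed.

Lemma quot_scale1 : left_id 1 quot_scale.
Proof. by move=> u; rewrite -(quot_piK u) quot_scaleE scale1r. Qed.

Lemma quot_scaleDr : right_distributive quot_scale +%R.
Proof.
move=> r u v; rewrite -(quot_piK u) -(quot_piK v) -raddfD !quot_scaleE.
by rewrite scalerDr raddfD.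
Qed.

Lemma quot_scaleDl u : {morph quot_scale^~ u : r s / r + s}.
Proof.
by move=> r s; rewrite -(quot_piK u) !quot_scaleE scalerDl raddfD.
Qed.

HB.instance Definition _ := GRing.Zmodule_isLmodule.Build R quot_carrier
  quot_scaleA quot_scale1 quot_scaleDr quot_scaleDl.

Lemma quot_piZ : scalable quot_pi.
Proof. by move=> r x; rewrite -[RHS]/(quot_scale r (quot_pi x)) quot_scaleE. Qed.

HB.instance Definition _ :=
  GRing.isScalable.Build R M quot_carrier *:%R quot_pi quot_piZ.

Definition quot_comp a (u : quot_carrier) : Prop :=
  exists2 x, gm_comp a x & u = quot_pi x.

Lemma quot_comp0 a : quot_comp a 0.
Proof. by exists 0; [apply: gm_comp0 | rewrite raddf0]. Qed.

Lemma quot_compB a u v : quot_comp a u -> quot_comp a v -> quot_comp a (u - v).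
Proof.
move=> [x hx ->] [y hy ->]; exists (x - y); first exact: gm_compB.
by rewrite raddfB.
Qed.

Lemma quot_compZ a b (r : R) u :
  homogeneous a r -> quot_comp b u -> quot_comp (a + b) (r *: u).
Proof.
move=> hr [x hx ->]; exists (r *: x); first exact: gm_compZ.
by rewrite linearZ.
Qed.

Lemma quot_span u : exists (s : seq deg) (f : deg -> quot_carrier),
  (forall a, quot_comp a (f a)) /\ u = \sum_(a <- s) f a.
Proof.
have [s [f [hf e]]] := gm_span (repr u).
exists s, (fun a => quot_pi (f a)); split=> [a|]; first by exists (f a).
by rewrite -raddf_sum -e; apply/esym/quot_piK.
Qed.

Lemma quot_indep (s : seq deg) (f : deg -> quot_carrier) :
  uniq s -> (forall a, quot_comp a (f a)) -> \sum_(a <- s) f a = 0 ->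
  forall a, a \in s -> f a = 0.
Proof.
move=> us hf e a sa.
have /choice[g hg] a' : exists x, gm_comp a' x /\ f a' = quot_pi x.
  by have [x hx ->] := hf a'; exists x.
rewrite (hg a).2 -(raddf0 quot_pi); apply/quot_piP; rewrite subr0.
apply: gs_homP sa => // [b|]; first exact: (hg b).1.
rewrite -[X in N X]subr0; apply/quot_piP; rewrite raddf_sum raddf0 -[RHS]e.
by apply: eq_bigr => b _; rewrite (hg b).2.
Qed.

Definition quot_graded : graded_module :=
  GradedModule quot_comp0 quot_compB quot_compZ quot_span quot_indep.

End SubQuotient.

Section Constructions.

Lemma zero_span (M : graded_module) (x : M) :
  x = 0 -> hspan (fun y : M => y = 0) x.
Proof. by move=> ->; apply: hspan0. Qed.

Definition zero_submodule (M : graded_module) : graded_submodule M.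
Proof.
apply: (@GradedSubmodule M (fun x => x = 0) erefl _ _ (@zero_span M)).
  by move=> x y -> ->; rewrite subr0.
by move=> r x ->; rewrite scaler0.
Defined.

Definition full_submodule (M : graded_module) : graded_submodule M.
Proof.
apply: (@GradedSubmodule M (fun=> True)) => // x _.
by apply: hspan_crit.
Defined.

Variables (M N : graded_module) (phi : graded_hom M N).

Definition kernel : graded_submodule M.
Proof.
apply: (@GradedSubmodule M (fun x => phi x = 0)).
- exact: raddf0.
- by move=> x y px py; rewrite raddfB /= px py subr0.
- by move=> r x px; rewrite linearZ /= px scaler0.
move=> x px; apply: hspan_crit; first exact: raddf0.
move=> s f us hf e.
apply: (gm_indep us (f := fun a => phi (f a))) => [a|].
  exact: gh_deg.
by rewrite -raddf_sum -e.
Defined.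

Definition image : graded_submodule N.
Proof.
apply: (@GradedSubmodule N (fun y => exists x, y = phi x)).
- by exists 0; rewrite raddf0.
- by move=> _ _ [x ->] [y ->]; exists (x - y); rewrite raddfB.
- by move=> r _ [x ->]; exists (r *: x); rewrite linearZ.
move=> _ [x ->]; have [s [f [hf ->]]] := gm_span x.
exists s, (fun a => phi (f a)); split; last exact: raddf_sum.
by move=> a; split; [apply: gh_deg | exists (f a)].
Defined.

(* This is Z :&: B seen inside Z; [cohomology] uses it with B contained in Z. *)
Definition sub_restrict (Z B : graded_submodule M) :
  graded_submodule (sub_graded Z).
Proof.
apply: (@GradedSubmodule (sub_graded Z) (fun z => B (val z))).
- by rewrite raddf0; apply: gs0.
- by move=> x y Bx By; rewrite raddfB; apply: gsB.
- by move=> r x Bx; rewrite linearZ; apply: gsZ.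
move=> z Bz; apply: hspan_crit; first by rewrite raddf0; apply: gs0.
move=> s f us hf e; apply: (gs_homP (f := fun a => val (f a))) => //.
by rewrite -raddf_sum -e.
Defined.

End Constructions.

Section QPart.
Variable M : graded_module.

Definition Qpart_mem (x : M) : Prop :=
  exists (s : seq deg) (f : deg -> M),
    [/\ {subset s <= Q}, forall a, gm_comp a (f a) & x = \sum_(a <- s) f a].

Lemma Qpart0 : Qpart_mem 0.
Proof.
by exists [::], (fun=> 0); split=> [//|a|]; rewrite ?big_nil //; apply: gm_comp0.
Qed.

Lemma QpartN x : Qpart_mem x -> Qpart_mem (- x).
Proof.
move=> [s [f [sQ hf ->]]]; exists s, (fun a => - f a); split=> // [a|].
  exact: gm_compN.
by rewrite raddf_sum.
Qed.

Lemma QpartD x y : Qpart_mem x -> Qpart_mem y -> Qpart_mem (x + y).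
Proof.
move=> [s [f [sQ hf ->]]] [t [g [tQ hg ->]]].
have [|||f' [hf' f0 ->]] := @sum_undup M (fun=> True) _ _ s f; rewrite //.
have [|||g' [hg' g0 ->]] := @sum_undup M (fun=> True) _ _ t g; rewrite //.
exists (undup (s ++ t)), (fun a => f' a + g' a); split=> [a|a|].
- by rewrite mem_undup mem_cat => /orP[/sQ|/tQ].
- by apply: gm_compD; [have [] := hf' a | have [] := hg' a].
rewrite big_split /=; congr (_ + _); apply/esym/sum_widen;
  rewrite ?undup_uniq // => a; rewrite !mem_undup ?mem_cat.
- by move=> ->.
- exact: f0.
- by move=> ->; rewrite orbT.
exact: g0.
Qed.

Lemma Qpart_sum (J : Type) (s : seq J) (P : pred J) (F : J -> M) :
  (forall j, P j -> Qpart_mem (F j)) -> Qpart_mem (\sum_(j <- s | P j) F j).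
Proof. by move=> hF; elim/big_ind: _ => //; [apply: Qpart0 | apply: QpartD]. Qed.

Lemma Qpart_hom a x : a \in Q -> gm_comp a x -> Qpart_mem x.
Proof.
move=> aQ hx; exists [:: a], (fun b => if b == a then x else 0).
rewrite big_seq1 eqxx; split=> // [b|b]; first by rewrite inE => /eqP ->.
by case: eqVneq => [->|_] //; apply: gm_comp0.
Qed.

Lemma QpartZ (r : R) x : Qpart_mem x -> Qpart_mem (r *: x).
Proof.
move=> [s [f [sQ hf ->]]].
have -> : r = \sum_(q <- msupp r) (<< r@_q *g q >> : R) by exact: monalgE.
rewrite scaler_suml; apply: Qpart_sum => q _.
rewrite scaler_sumr big_seq; apply: Qpart_sum => a /sQ aQ.
apply: (@Qpart_hom (so_val q + a)); first exact: rpredD (so_valP q) aQ.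
by apply: gm_compZ => //; apply: homogeneousU.
Qed.

Definition Qpart : graded_submodule M.
Proof.
apply: (@GradedSubmodule M Qpart_mem Qpart0 _ QpartZ).
  by move=> x y Qx Qy; apply/QpartD/QpartN.
move=> x [s [f [sQ hf ->]]]; apply: hspan_sum => [||a sa].
- exact: Qpart0.
- exact: QpartD.
by apply: hspan_hom (hf a) _; [apply: Qpart0 | apply: Qpart_hom (hf a); apply: sQ].
Defined.

End QPart.

Section IdealPower.

Definition ideal_mul_mem (I J : graded_ideal) (x : R^o) : Prop :=
  exists s : seq (R * R),
    (forall p, p \in s -> I p.1 /\ J p.2) /\ x = \sum_(p <- s) p.1 * p.2.

Section Product.
Variables (I J : graded_ideal).

Lemma ideal_mul0 : ideal_mul_mem I J 0.
Proof. by exists [::]; rewrite big_nil. Qed.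

Lemma ideal_mulD x y :
  ideal_mul_mem I J x -> ideal_mul_mem I J y -> ideal_mul_mem I J (x + y).
Proof.
move=> [s [hs ->]] [t [ht ->]]; exists (s ++ t); split; last by rewrite big_cat.
by move=> p; rewrite mem_cat => /orP[/hs|/ht].
Qed.

Lemma ideal_mulZ (r : R) x : ideal_mul_mem I J x -> ideal_mul_mem I J (r *: x).
Proof.
move=> [s [hs ->]]; exists [seq (r * p.1, p.2) | p <- s]; split.
  by move=> _ /mapP[p /hs[Ip Jp] ->] /=; split=> //; apply: gsZ.
rewrite big_map scaler_sumr; apply: eq_bigr => p _ /=.
by rewrite -mulrA.
Qed.

Lemma ideal_mulB x y :
  ideal_mul_mem I J x -> ideal_mul_mem I J y -> ideal_mul_mem I J (x - y).
Proof. by move=> hx hy; rewrite -scaleN1r; apply/ideal_mulD/ideal_mulZ. Qed.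

Lemma ideal_mul_span (x : regular_graded) :
  ideal_mul_mem I J x -> hspan (ideal_mul_mem I J : regular_graded -> Prop) x.
Proof.
have hsum := @hspan_sum regular_graded _ ideal_mul0 ideal_mulD.
move=> [s [hs ->]]; apply: (hsum _ s _) => p /hs[Ip Jp].
have [t [f [hf ->]]] := gs_span Ip; have [u [g [hg ->]]] := gs_span Jp.
rewrite mulr_suml.
apply: (hsum _ t (fun a => (f a : R) * \sum_(b <- u) g b)) => a _.
rewrite mulr_sumr; apply: (hsum _ u (fun b => (f a : R) * g b)) => b _.
have [fa Ifa] := hf a; have [gb Jgb] := hg b.
apply: (@hspan_hom regular_graded _ ideal_mul0 (a + b)).
  exact: homogeneousM.
exists [:: (f a : R, g b : R)]; rewrite big_seq1; split=> // q.
by rewrite inE => /eqP ->.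
Qed.

Definition ideal_mul : graded_ideal :=
  @GradedSubmodule regular_graded (ideal_mul_mem I J)
    ideal_mul0 ideal_mulB ideal_mulZ ideal_mul_span.

End Product.

Fixpoint ideal_pow (I : graded_ideal) (n : nat) : graded_ideal :=
  if n is n'.+1 then ideal_mul I (ideal_pow I n')
  else full_submodule regular_graded.

Lemma ideal_powD (I : graded_ideal) m n x :
  ideal_pow I (m + n) x -> ideal_pow I n x.
Proof.
elim: m x => [//|m IHm] x; rewrite addSn => -[s [hs ->]].
apply: gs_sum => p /hs[_ /IHm h].
exact: gsZ.
Qed.

End IdealPower.

Section Torsion.
Variable I : graded_ideal.

Definition torsion (M : graded_module) : graded_submodule M.
Proof.
apply: (@GradedSubmodule M
  (fun x => exists n : nat, forall r : R, ideal_pow I n r -> r *: x = 0)).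
- by exists 0%N => r _; rewrite scaler0.
- move=> x y [m hx] [n hy]; exists (m + n)%N => r hr.
  have rn := ideal_powD hr; rewrite addnC in hr.
  by rewrite scalerBr (hx _ (ideal_powD hr)) (hy _ rn) subr0.
- by move=> r x [n hx]; exists n => s /hx sx; rewrite scalerA mulrC -scalerA sx scaler0.
move=> x [n hx]; apply: hspan_crit; first by exists 0%N => r _; rewrite scaler0.
move=> s f us hf e a sa; exists n => r /gs_span[t [g [hg ->]]].
rewrite scaler_suml big1 // => b _; have [gb Igb] := hg b.
have ub : uniq [seq b + c | c <- s] by rewrite map_inj_uniq //; apply: addrI.
have := gm_indep ub (f := fun c => (g b : R) *: f (c - b)).
have -> : f a = f (b + a - b) by rewrite [b + a]addrC addrK.
apply.
- by move=> c; rewrite -{1}(subrK b c) [_ + b]addrC; apply: gm_compZ.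
- rewrite big_map (eq_bigr (fun c => (g b : R) *: f c)) => [|c _].
    by rewrite -scaler_sumr -e; apply: hx.
  by rewrite [b + c]addrC addrK.
exact: map_f.
Defined.

Definition Gamma (M : graded_module) : graded_module := sub_graded (torsion M).

Variables (M N : graded_module) (phi : graded_hom M N).

Lemma torsion_hom (x : M) : torsion M x -> torsion N (phi x).
Proof.
by move=> [n hx]; exists n => r /hx rx; rewrite -linearZ rx raddf0.
Qed.

Definition Gamma_fun (x : Gamma M) : Gamma N :=
  sub_elt (torsion_hom (sub_memP x)).

Lemma Gamma_fun_linear : linear Gamma_fun.
Proof. by move=> r x y; apply: val_inj; rewrite /= !linearP. Qed.

HB.instance Definition _ :=
  GRing.isLinear.Build R (Gamma M) (Gamma N) *:%R Gamma_fun Gamma_fun_linear.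

Lemma Gamma_fun_deg a (x : Gamma M) : gm_comp a x -> gm_comp a (Gamma_fun x).
Proof. exact: (@gh_deg _ _ phi a (val x)). Qed.

Definition Gamma_hom : graded_hom (Gamma M) (Gamma N) :=
  GradedHom Gamma_fun_deg.

End Torsion.

Record cochain_complex := CochainComplex {
  cc_obj :> nat -> graded_module;
  cc_d : forall n, graded_hom (cc_obj n) (cc_obj n.+1);
  cc_dd : forall n x, cc_d n.+1 (cc_d n x) = 0 }.

Definition coboundaries (C : cochain_complex) (n : nat) : graded_submodule (C n) :=
  if n is m.+1 return graded_submodule (C n) then image (cc_d C m)
  else zero_submodule (C 0).

Definition cohomology (C : cochain_complex) (n : nat) : graded_module :=
  quot_graded (sub_restrict (kernel (cc_d C n)) (coboundaries C n)).

Lemma Gamma_dd (I : graded_ideal) (C : cochain_complex) n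
    (x : Gamma I (C n)) :
  Gamma_hom I (cc_d C n.+1) (Gamma_hom I (cc_d C n) x) = 0.
Proof. by apply: val_inj; rewrite /= cc_dd. Qed.

Definition Gamma_complex (I : graded_ideal) (C : cochain_complex) :
  cochain_complex := CochainComplex (@Gamma_dd I C).

Definition injective_object (J : graded_module) : Prop :=
  forall (A B : graded_module) (i : graded_hom A B) (f : graded_hom A J),
    injective i -> exists g : graded_hom B J, forall x, g (i x) = f x.

Record injective_resolution (M : graded_module) := InjectiveResolution {
  ir_complex :> cochain_complex;
  ir_aug : graded_hom M (ir_complex 0);
  ir_injective : forall n, injective_object (ir_complex n);
  ir_aug_inj : injective ir_aug;
  ir_exact0 : forall x, cc_d ir_complex 0 x = 0 <-> exists y, x = ir_aug y;
  ir_exactS : forall n x,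
    cc_d ir_complex n.+1 x = 0 <-> exists y, x = cc_d ir_complex n y }.

(* The right derived functors are defined up to isomorphism: they are computed
   from any injective resolution, which is therefore a parameter. *)
Definition local_cohomology (I : graded_ideal) (M : graded_module)
    (E : injective_resolution M) (i : nat) : graded_module :=
  cohomology (Gamma_complex I E) i.

End Graded.

Arguments regular_graded k {d} Q.

Notation graded_ideal k Q := (graded_submodule (regular_graded k Q)).

(* Main.v *)
From HB Require Import structures.
Require Import Defs.
From mathcomp Require Import all_boot all_order all_algebra.
From mathcomp Require Import finmap boolp monalg.
From mathcomp Require classical_sets.

(** Write [N_Q] for the Q-graded part of [N].  Taking Q-graded parts is exact and
commutes with the torsion functor, and maps from Q-graded modules into an
injective [E n] land in [(E n)_Q].  Hence [H^i_I(M)_Q] is computed inside the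
category of Q-graded modules, and the point of passing to this category is that
it has enough injectives which are finitely generated.

Indeed [Q], ordered by divisibility, is a preorder in which 0 is a least
element, and a Q-graded module is a representation of it.  For a directed
down-set [T], the representation [k{T}] with value [k] on [T] and 0 elsewhere is
injective ([trunc_Qinjective]: a map into it is a linear functional on a
directed colimit, and those extend by Zorn's lemma), and it is cyclic, being
[k[Q]] modulo the monomials outside [T].  A finitely generated Q-graded module
embeds in a finite product of such [k{T}] ([Qgraded_embedding]); this is
primary decomposition, run as a Noetherian induction.  Noetherianity itself
([noetherian]) comes from Dickson's lemma, because every homogeneous element of
[k[Q]] is a scalar multiple of a monomial.

The resolution [E] of the statement is arbitrary, so it is compared with a
resolution by finitely generated injectives, one step at a time.  Let [Z n] be
the Q-graded part of the n-cocycles of [E].  By induction on [n] there are a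
finitely generated Q-graded module [N] and maps [phi : N -> E n] and
[gamma : Z n -> N] such that [phi \o gamma] is the inclusion up to a
null-homotopic map ([fg_approximation]).  In degree 0, [N] is [M_Q]; to go on,
embed [N] in a finitely generated Q-injective [W] and replace [N] by [W / N].
All these maps preserve torsion, so [phi] maps the finitely generated torsion
submodule of [N] onto [H^n_I(M)_Q]. *)

Set Implicit Arguments.
Unset Strict Implicit.
Unset Printing Implicit Defensive.

Import GRing.Theory.
Local Open Scope ring_scope.

(** * Homogeneous components *)

Section Components.
Variables (k : fieldType) (d : nat) (Q : addrClosed 'rV[int]_d).
Local Notation R := (semigroup_ring k Q).
Local Notation deg := 'rV[int]_d.
Implicit Types (M N : graded_module k Q) (a b : deg).

(** The definition is locked: unification of two distinct monomials would
otherwise unfold finitely supported functions. *)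
Fact monomial_key : unit. Proof. exact: tt. Qed.
Definition monomial : k -> subset_of Q -> R :=
  locked_with monomial_key (fun c q => << c *g q >> : R).

Lemma monomialE c q : monomial c q = << c *g q >>.
Proof. by rewrite /monomial unlock. Qed.

Lemma monomial_deg c q : homogeneous (so_val q) (monomial c q).
Proof. by rewrite monomialE; apply: homogeneousU. Qed.

Lemma monomialM c1 c2 q1 q2 :
  monomial c1 q1 * monomial c2 q2 = monomial (c1 * c2) (q1 + q2).
Proof. by rewrite !monomialE; apply: ma_mulUU. Qed.

Lemma monomial0 q : monomial 0 q = 0.
Proof. by rewrite monomialE; apply: monalgU0. Qed.

Lemma monomial1 : monomial 1 0 = 1.
Proof. by rewrite monomialE. Qed.

Lemma monomialD c1 c2 q : monomial (c1 + c2) q = monomial c1 q + monomial c2 q.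
Proof. by rewrite !monomialE; apply: monalgUD. Qed.

Lemma monomial_sum (r : R) : r = \sum_(q <- msupp r) monomial (r@_q) q.
Proof. by rewrite [LHS]monalgE; apply: eq_bigr => q _; rewrite monomialE. Qed.

Lemma coef_monomial c q q' : (monomial c q)@_q' = if q == q' then c else 0.
Proof. by rewrite monomialE mcoeffU; case: ifP. Qed.

(** The grading is fine: each graded piece of [k[Q]] has dimension at most 1.
This is what reduces every question on ideals to combinatorics of [Q]. *)
Lemma homogeneous_monomial a (r : R) : homogeneous a r ->
  r = 0 \/ exists q c, so_val q = a /\ r = monomial c q.
Proof.
move=> hr; have [r0|/existsNP[q rq]] := pselect (forall q, r@_q = 0).
  by left; apply/malgP => q; rewrite r0 mcoeff0.
right; exists q, (r@_q); move/eqP: rq => rq; split; first exact: hr.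
apply/malgP => q'; rewrite coef_monomial; case: eqVneq => [<-//|qq'].
apply/eqP/negPn/negP => /hr; rewrite -(hr _ rq) => /val_inj e.
by rewrite e eqxx in qq'.
Qed.

Section Comp.
Variable M : graded_module k Q.

(** A finite set of degrees carrying [x], chosen together with the components of
[x]; only the components are independent of the choice ([hcomp_unique]). *)
Definition hsupp (x : M) : seq deg := sval (cid (decomposition x)).
Definition hcomp a (x : M) : M := sval (cid (svalP (cid (decomposition x)))) a.

Lemma hsupp_comp (x : M) : [/\ uniq (hsupp x), forall a, gm_comp a (hcomp a x),
  forall a, a \notin hsupp x -> hcomp a x = 0 & x = \sum_(a <- hsupp x) hcomp a x].
Proof. exact: (svalP (cid (svalP (cid (decomposition x))))). Qed.

Lemma hsupp_uniq x : uniq (hsupp x). Proof. by have [] := hsupp_comp x. Qed.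
Lemma hcomp_deg a x : gm_comp a (hcomp a x). Proof. by have [] := hsupp_comp x. Qed.
Lemma hcomp_out a x : a \notin hsupp x -> hcomp a x = 0.
Proof. by have [_ _ h _] := hsupp_comp x; apply: h. Qed.
Lemma hcomp_sum x : x = \sum_(a <- hsupp x) hcomp a x.
Proof. by have [] := hsupp_comp x. Qed.

Lemma hcomp_unique (s : seq deg) (f : deg -> M) x :
  uniq s -> (forall a, gm_comp a (f a)) -> (forall a, a \notin s -> f a = 0) ->
  x = \sum_(a <- s) f a -> forall a, hcomp a x = f a.
Proof.
move=> us hf f0 e a; have ut := undup_uniq (s ++ hsupp x).
have [|] := boolP (a \in undup (s ++ hsupp x)); last first.
  rewrite mem_undup mem_cat negb_or => /andP[/f0 -> /hcomp_out ->//].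
move=> ta; apply/eqP; rewrite -subr_eq0; apply/eqP.
apply: (gm_indep ut (f := fun a => hcomp a x - f a)) ta => [b|].
  by apply: gm_compB => //; apply: hcomp_deg.
rewrite sumrB (sum_widen (s := hsupp x)) ?hsupp_uniq //.
- rewrite -hcomp_sum (sum_widen (s := s)) //; first by rewrite -e subrr.
  by move=> b bs; rewrite mem_undup mem_cat bs.
- by move=> b bs; rewrite mem_undup mem_cat bs orbT.
by move=> b; apply: hcomp_out.
Qed.

Lemma hcomp_id a x : gm_comp a x -> hcomp a x = x.
Proof.
move=> hx; rewrite (@hcomp_unique [:: a] (fun b => if b == a then x else 0) x) ?eqxx//.
- by move=> b; case: eqP => [->//|_]; apply: gm_comp0.
- by move=> b; rewrite inE => /negbTE ->.
by rewrite big_seq1 eqxx.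
Qed.

Lemma hcomp_neq a b x : gm_comp b x -> a != b -> hcomp a x = 0.
Proof.
move=> hx /negbTE ab.
rewrite (@hcomp_unique [:: b] (fun c => if c == b then x else 0) x) ?ab//.
- by move=> c; case: eqP => [->//|_]; apply: gm_comp0.
- by move=> c; rewrite inE => /negbTE ->.
by rewrite big_seq1 eqxx.
Qed.

Lemma hcomp_is_additive a : {morph hcomp a : x y / x - y}.
Proof.
move=> x y; set t := undup (hsupp x ++ hsupp y).
apply: (@hcomp_unique t (fun b => hcomp b x - hcomp b y)).
- exact: undup_uniq.
- by move=> b; apply: gm_compB; apply: hcomp_deg.
- by move=> b; rewrite mem_undup mem_cat negb_or => /andP[? ?]; rewrite !hcomp_out ?subrr.
rewrite sumrB {1}(hcomp_sum x) {1}(hcomp_sum y); congr (_ - _);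
  apply/esym/sum_widen; rewrite ?undup_uniq ?hsupp_uniq //;
  by [move=> b bs; rewrite mem_undup mem_cat bs ?orbT | move=> b /hcomp_out].
Qed.

HB.instance Definition _ a :=
  GRing.isZmodMorphism.Build M M (hcomp a) (hcomp_is_additive a).

End Comp.

Lemma hcomp_gh M N (g : graded_hom M N) a x : hcomp a (g x) = g (hcomp a x).
Proof.
apply: (@hcomp_unique N (hsupp x) (fun a => g (hcomp a x))).
- exact: hsupp_uniq.
- by move=> b; apply/gh_deg/hcomp_deg.
- by move=> b /hcomp_out ->; rewrite raddf0.
by rewrite -raddf_sum -hcomp_sum.
Qed.

Lemma hcomp_gs M (N : graded_submodule M) a x : N x -> N (hcomp a x).
Proof.
have [|/hcomp_out -> _] := boolP (a \in hsupp x); last exact: gs0.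
move=> sa; rewrite {1}(hcomp_sum x) => h.
exact: (gs_homP (hsupp_uniq x) (fun b => hcomp_deg b x) h).
Qed.

(** Multiplying a homogeneous element shifts degrees, so the components of the
scalar can be read off from those of the product.  Through this lemma arbitrary
coefficients are replaced by monomials. *)
Lemma hcompZ_hom M a b (r : regular_graded k Q) (x : M) :
  gm_comp b x -> hcomp (a + b) ((r : R) *: x) = (hcomp a r : R) *: x.
Proof.
move=> hx; rewrite {1}(hcomp_sum r) scaler_suml raddf_sum /=.
have e c : hcomp (a + b) ((hcomp c r : R) *: x) = if c == a then (hcomp a r : R) *: x else 0.
  have [->|ca] := eqVneq c a.
    by rewrite hcomp_id //; apply: gm_compZ => //; exact: (hcomp_deg a r).
  rewrite (@hcomp_neq _ _ (c + b)) //.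
    by apply: gm_compZ => //; exact: (hcomp_deg c r).
  by rewrite (inj_eq (addIr b)) eq_sym.
rewrite (eq_bigr _ (fun c _ => e c)).
have [sa|sa] := boolP (a \in hsupp r); last first.
  rewrite (hcomp_out sa) scale0r big1 // => c _.
  by rewrite if_same.
rewrite (bigD1_seq a) ?hsupp_uniq //= eqxx big1 ?addr0 // => c /negbTE ->.
by [].
Qed.

Section SubmoduleOfComponents.
Variables (M : graded_module k Q) (P : M -> Prop).
Hypotheses (P0 : P 0) (PB : forall x y, P x -> P y -> P (x - y)).
Hypotheses (PZ : forall (r : R) x, P x -> P (r *: x)).
Hypothesis PC : forall a x, P x -> P (hcomp a x).

Lemma hcomp_hspan x : P x -> hspan P x.
Proof.
move=> Px; exists (hsupp x), (fun a => hcomp a x); split; last exact: hcomp_sum.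
by move=> a; split; [apply: hcomp_deg | apply: PC].
Qed.

Definition submodule_of_hcomp : graded_submodule M := GradedSubmodule P0 PB PZ hcomp_hspan.

Lemma gs_intro : exists N : graded_submodule M, forall x, N x <-> P x.
Proof. by exists submodule_of_hcomp. Qed.

End SubmoduleOfComponents.

Lemma gh_intro M N (g : M -> N) : linear g ->
  (forall a x, gm_comp a x -> gm_comp a (g x)) ->
  exists h : graded_hom M N, forall x, h x = g x.
Proof.
move=> gl gd; pose L : {linear M -> N} := HB.pack g (GRing.isLinear.Build _ _ _ _ g gl).
by exists (@GradedHom _ _ _ M N L gd).
Qed.

Lemma gh_comp (A B C : graded_module k Q) (g : graded_hom B C) (f : graded_hom A B) :
  exists h : graded_hom A C, forall x, h x = g (f x).
Proof.
apply: gh_intro; first by move=> r x y; rewrite !linearP.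
by move=> a x hx; apply/gh_deg/gh_deg.
Qed.

Lemma gh_quot M (P : graded_submodule M) :
  exists pi : graded_hom M (quot_graded P), forall y, pi y = quot_pi P y.
Proof.
apply: gh_intro; first by move=> r y z; rewrite linearP.
by move=> a y hy; exists y.
Qed.

(** A preimage of a homogeneous element may be taken homogeneous, by keeping one
component of any preimage; this makes the induced map preserve degrees. *)
Lemma gh_factor (A B C : graded_module k Q) (p : graded_hom A B) (f : graded_hom A C) :
  (forall y, exists x, y = p x) -> (forall x, p x = 0 -> f x = 0) ->
  exists g : graded_hom B C, forall x, g (p x) = f x.
Proof.
move=> /choice[s hs] pf.
have fs x : f (s (p x)) = f x.
  apply/eqP; rewrite -subr_eq0 -raddfB; apply/eqP/pf.
  by rewrite raddfB /= -hs subrr.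
have [||g hg] := @gh_intro B C (fun y => f (s y)).
- by move=> r x y; rewrite (hs x) (hs y) -linearP !fs linearP.
- move=> a y hy; have -> : y = p (hcomp a (s y)).
    by rewrite -hcomp_gh -hs hcomp_id.
  by rewrite fs; apply/gh_deg/hcomp_deg.
by exists g => x; rewrite hg fs.
Qed.

(** Since the module is the direct sum of its pieces and the ring is spanned by
monomials, it is enough to check linearity piecewise and against monomials. *)
Lemma gh_extend M N (phi : deg -> M -> N) :
  (forall a x, gm_comp a x -> gm_comp a (phi a x)) ->
  (forall a x y, gm_comp a x -> gm_comp a y -> phi a (x + y) = phi a x + phi a y) ->
  (forall a (q : subset_of Q) (c : k) x, gm_comp a x ->
     phi (so_val q + a) (monomial c q *: x) = monomial c q *: phi a x) ->
  exists g : graded_hom M N, forall a x, gm_comp a x -> g x = phi a x.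
Proof.
move=> pdeg pD pZ; pose g x := \sum_(a <- hsupp x) phi a (hcomp a x).
have p0 a : phi a 0 = 0.
  by apply: (addrI (phi a 0)); rewrite -pD ?addr0 //; apply: gm_comp0.
have gw (s : seq deg) x : uniq s -> {subset hsupp x <= s} ->
    g x = \sum_(a <- s) phi a (hcomp a x).
  move=> us xs; apply/esym/sum_widen => //; first exact: hsupp_uniq.
  by move=> a /hcomp_out ->.
have gD x y : g (x + y) = g x + g y.
  pose t := undup (hsupp x ++ hsupp y ++ hsupp (x + y)).
  have ut : uniq t by apply: undup_uniq.
  rewrite !(@gw t) //; try by move=> b bs; rewrite mem_undup !mem_cat bs ?orbT.
  rewrite -big_split; apply: eq_bigr => a _ /=.
  by rewrite raddfD pD //; apply: hcomp_deg.
have g0 : g 0 = 0.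
  by rewrite /g big1 // => a _; rewrite raddf0.
have gh a x : gm_comp a x -> g x = phi a x.
  move=> hx; rewrite (@gw (undup (a :: hsupp x))) ?undup_uniq //; last first.
    by move=> b bs; rewrite mem_undup inE bs orbT.
  rewrite (bigD1_seq a) ?undup_uniq ?mem_undup ?mem_head //=.
  by rewrite hcomp_id // big1 ?addr0 // => b ba; rewrite (hcomp_neq hx) ?p0.
have gsum (J : Type) (s : seq J) F : g (\sum_(j <- s) F j) = \sum_(j <- s) g (F j).
  exact: (big_morph g gD g0).
have gU (q : subset_of Q) c x : g (monomial c q *: x) = monomial c q *: g x.
  rewrite {1}(hcomp_sum x) scaler_sumr gsum [g x]/g scaler_sumr; apply: eq_bigr => a _.
  rewrite -pZ; last exact: hcomp_deg.
  apply: gh; apply: gm_compZ; last exact: hcomp_deg.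
  exact: monomial_deg.
have gZ (r : R) x : g (r *: x) = r *: g x.
  by rewrite (monomial_sum r) !scaler_suml gsum; apply: eq_bigr => q _; apply: gU.
have [||h hh] := @gh_intro M N g.
- by move=> r x y; rewrite gD gZ.
- by move=> a x hx; rewrite (gh a) //; apply: pdeg.
by exists h => a x hx; rewrite hh; apply: gh.
Qed.

End Components.

(** * Finiteness conditions on the semigroup and on graded modules *)

Section Dickson.
Variable V : zmodType.

Fixpoint nspan (gs : seq V) (a : V) : Prop :=
  if gs is g :: gs' then exists m, nspan gs' (a - g *+ m) else a = 0.

(** Dickson's lemma, stated for the order [a - p \in <gs>] on the monoid [<gs>]
generated by [gs], in which [gs] need not be free.  Induction on [gs] splits
off one generator [g] and looks at the slices [{b | b + g *+ m \in L}]: finitely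
many elements generate the union of all slices, they already occur at levels
below some [m0], and the finitely many slices under [m0] are treated
separately. *)
Lemma dickson (gs : seq V) (L : V -> Prop) : (forall a, L a -> nspan gs a) ->
  exists s : seq V, (forall p, p \in s -> L p) /\
    forall a, L a -> exists2 p, p \in s & nspan gs (a - p).
Proof.
elim: gs L => [|g gs IH] L hL.
  have [[a La]|nL] := pselect (exists a, L a); last first.
    by exists [::]; split=> // a La; case: nL; exists a.
  exists [:: a]; split=> [p|b Lb]; first by rewrite inE => /eqP ->.
  by exists a; rewrite ?mem_head //= (hL a La) (hL b Lb) subrr.
have [s [sL hs]] := IH (fun b => nspan gs b /\ exists m, L (b + g *+ m)) (fun b => @proj1 _ _).
have /choice[mu hmu] b : exists m, b \in s -> L (b + g *+ m).
  have [/sL[_ [m Lm]]|_] := boolP (b \in s); last by exists 0%N.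
  by exists m.
have /choice[t ht] m := IH (fun b => nspan gs b /\ L (b + g *+ m)) (fun b => @proj1 _ _).
(* from level m0 on, the generators of the union of the slices suffice *)
pose m0 := (\max_(b <- s) mu b)%N.
exists ([seq b + g *+ mu b | b <- s] ++
        flatten [seq [seq b + g *+ m | b <- t m] | m <- iota 0 m0]); split.
  move=> p; rewrite mem_cat => /orP[/mapP[b sb ->]|]; first exact: hmu.
  by move=> /flattenP[_ /mapP[m _ ->] /mapP[b tb ->]]; have [_] := (ht m).1 b tb.
move=> a La; have [m hm] := hL a La.
have Lm : L (a - g *+ m + g *+ m) by rewrite subrK.
have [mm|mm] := ltnP m m0.
  have [b tb hb] := (ht m).2 _ (conj hm Lm).
  exists (b + g *+ m).
    rewrite mem_cat; apply/orP; right; apply/flattenP.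
    exists [seq b + g *+ m | b <- t m]; last exact: map_f.
    by apply: map_f; rewrite mem_iota.
  by exists 0%N; rewrite mulr0n subr0 opprD addrA addrAC.
have [b sb hb] := hs _ (conj hm (ex_intro _ m Lm)).
exists (b + g *+ mu b); first by rewrite mem_cat (map_f (fun b => b + g *+ mu b) sb).
exists (m - mu b)%N; rewrite mulrnBr; last first.
  by apply: leq_trans mm; apply: (@leq_bigmax_seq _ s xpredT mu).
move: hb; congr nspan.
by rewrite opprB opprD !addrA subrK addrAC.
Qed.

End Dickson.

Section Noetherian.
Variables (k : fieldType) (d : nat) (Q : addrClosed 'rV[int]_d).
Local Notation R := (semigroup_ring k Q).
Local Notation deg := 'rV[int]_d.
Implicit Types (M N : graded_module k Q) (a b : deg).

Section Span.
Variable M : lmodType R.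
Implicit Types (s t : seq M) (x y : M).

(** Spans by lists, eliminating one generator at a time: this suits inductions on
the generators better than families of coefficients indexed by ['I_n]. *)
Fixpoint spanned s x : Prop :=
  if s is y :: s' then exists r : R, spanned s' (x - r *: y) else x = 0.

Lemma spanned0 s : spanned s 0.
Proof. by elim: s => //= y s IH; exists 0; rewrite scale0r subr0. Qed.

Lemma spannedB s x y : spanned s x -> spanned s y -> spanned s (x - y).
Proof.
elim: s x y => /= [|z s IH] x y; first by move=> -> ->; rewrite subr0.
move=> [r hx] [r' hy]; exists (r - r'); move: (IH _ _ hx hy); congr spanned.
by rewrite scalerBl !opprB [_ *: z - y]addrC addrACA [- _ + _]addrC.
Qed.

Lemma spannedZ s (r : R) x : spanned s x -> spanned s (r *: x).
Proof.
elim: s x => /= [|z s IH] x; first by move=> ->; rewrite scaler0.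
by move=> [r' /IH hx]; exists (r * r'); rewrite -scalerA -scalerBr.
Qed.

Lemma spannedD s x y : spanned s x -> spanned s y -> spanned s (x + y).
Proof.
move=> hx hy; rewrite -[y]opprK; apply: spannedB => //; rewrite -scaleN1r; exact: spannedZ.
Qed.

Lemma spanned_sum s (J : eqType) (t : seq J) (F : J -> M) :
  (forall j, j \in t -> spanned s (F j)) -> spanned s (\sum_(j <- t) F j).
Proof.
move=> hF; rewrite big_seq; elim/big_rec: _ => [|j x /hF]; first exact: spanned0.
exact: spannedD.
Qed.

Lemma spanned_mem s x : x \in s -> spanned s x.
Proof.
elim: s => //= y s IH; rewrite inE => /orP[/eqP->|/IH h].
  by exists 1; rewrite scale1r subrr; apply: spanned0.
by exists 0; rewrite scale0r subr0.
Qed.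

Lemma spanned_trans s t x :
  (forall y, y \in s -> spanned t y) -> spanned s x -> spanned t x.
Proof.
elim: s x => /= [|y s IH] x st; first by move=> ->; apply: spanned0.
move=> [r /IH h]; rewrite -(subrK (r *: y) x); apply: spannedD.
  by apply: h => z zs; apply: st; rewrite inE zs orbT.
by apply/spannedZ/st/mem_head.
Qed.

Lemma spanned_sub s t x : {subset s <= t} -> spanned s x -> spanned t x.
Proof. by move=> st; apply: spanned_trans => y /st; apply: spanned_mem. Qed.

Lemma spannedE s x : spanned s x ->
  exists c : nat -> R, x = \sum_(i < size s) c i *: s`_i.
Proof.
elim: s x => /= [|y s IH] x; first by move=> ->; exists (fun=> 0); rewrite big_ord0.
move=> [r /IH[c e]]; exists (fun i => if i is j.+1 then c j else r).
by rewrite big_ord_recl /= -e addrC subrK.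
Qed.

Lemma fgP : finitely_generated M <-> exists s : seq M, forall x, spanned s x.
Proof.
split=> [[n [g hg]]|[s hs]].
  exists [seq g i | i <- enum 'I_n] => x; have [c ->] := hg x.
  apply: spanned_sum => i _; apply/spannedZ/spanned_mem/map_f.
  by rewrite mem_enum.
exists (size s), (fun i => s`_i) => x; have [c e] := spannedE (hs x).
by exists c.
Qed.

End Span.

Lemma spanned_map (M N : lmodType R) (f : {linear M -> N}) (s : seq M) x :
  spanned s x -> spanned (map f s) (f x).
Proof.
elim: s x => /= [|y s IH] x; first by move=> ->; rewrite raddf0.
by move=> [r /IH h]; exists r; rewrite -linearZ -raddfB.
Qed.

Lemma fg_surj (M N : lmodType R) (f : {linear M -> N}) :
  (forall y, exists x, y = f x) -> finitely_generated M -> finitely_generated N.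
Proof.
move=> fs /fgP[s hs]; apply/fgP; exists (map f s) => y.
by have [x ->] := fs y; apply: spanned_map.
Qed.

Lemma spanned_val M (P : graded_submodule M) (s : seq M) :
  (forall y, y \in s -> P y) -> (forall x, P x -> spanned s x) ->
  finitely_generated (sub_graded P).
Proof.
move=> sP hs; apply/fgP.
have [t et] : exists t : seq (sub_graded P), map (fun z : sub_graded P => val z) t = s.
  elim: s sP {hs} => [|y s IH] sP; first by exists [::].
  have [|t et] := IH; first by move=> z zs; apply: sP; rewrite inE zs orbT.
  by exists (sub_elt (sP y (mem_head _ _)) :: t); rewrite /= et.
exists t => x; have := hs _ (sub_memP x); rewrite -et.
elim: t x {et sP hs} => [|y t IH] x; first by move=> h; apply: val_inj; rewrite raddf0; exact: h.
by move=> [r h]; exists r; apply: IH; rewrite raddfB [X in _ - X]linearZ.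
Qed.

Lemma val_spanned M (P : graded_submodule M) :
  finitely_generated (sub_graded P) ->
  exists s : seq M, (forall y, y \in s -> P y) /\ (forall x, P x -> spanned s x).
Proof.
move=> /fgP[s hs]; exists (map (fun z : sub_graded P => val z) s); split.
  by move=> _ /mapP[y _ ->]; apply: sub_memP.
move=> x Px; have := hs (sub_elt Px).
exact: (@spanned_map (sub_graded P) M (val : {linear sub_graded P -> M})).
Qed.

Lemma hcomp_spanned M (s : seq M) a x : (forall y, y \in s -> exists b, gm_comp b y) ->
  spanned s x -> spanned s (hcomp a x).
Proof.
elim: s x => /= [|y s IH] x hs; first by move=> ->; rewrite raddf0.
have [b hy] := hs y (mem_head _ _).
have hs' z (zs : z \in s) : exists b, gm_comp b z by apply: hs; rewrite inE zs orbT.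
move=> [r h]; exists (hcomp (a - b) (r : regular_graded k Q)).
by have := IH _ hs' h; rewrite raddfB /= -[in hcomp a (r *: y)](subrK b a) hcompZ_hom.
Qed.

(** The homogeneous components of generators are again generators. *)
Lemma fg_homogeneous M : finitely_generated M ->
  exists s : seq M, (forall y, y \in s -> exists b, gm_comp b y) /\ forall x, spanned s x.
Proof.
move=> /fgP[s hs]; exists (flatten [seq [seq hcomp a y | a <- hsupp y] | y <- s]); split.
  by move=> _ /flattenP[_ /mapP[y _ ->] /mapP[a _ ->]]; exists a; apply: hcomp_deg.
move=> x; apply: spanned_trans (hs x) => y ys; rewrite (hcomp_sum y).
apply: spanned_sum => a ya; apply: spanned_mem; apply/flattenP.
by exists [seq hcomp a y | a <- hsupp y]; apply: map_f.
Qed.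

Hypothesis hQ : affine_semigroup Q.

Lemma dickson_Q (L : subset_of Q -> Prop) : exists s : seq (subset_of Q),
  (forall p, p \in s -> L p) /\ forall q, L q -> exists p r, p \in s /\ q = r + p.
Proof.
have [[gs [gsQ hgs]] _] := hQ.
have nQ a : nspan gs a -> a \in Q.
  elim: gs gsQ {hgs} a => /= [|g gs IH] gsQ a; first by move=> ->; apply: rpred0.
  move=> [m /IH h]; rewrite -(subrK (g *+ m) a); apply: rpredD.
    by apply: h => b bs; apply: gsQ; rewrite inE bs orbT.
  by rewrite rpredMn // gsQ // mem_head.
have Qn a : a \in Q -> nspan gs a.
  move=> /hgs[m ->] {hgs gsQ nQ}; elim: gs m => [|g gs IH] m; first by rewrite big_ord0.
  rewrite /= big_ord_recl /=; exists (m ord0); rewrite addrAC subrr add0r.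
  exact: (IH (fun i => m (lift ord0 i))).
have [|s [sL hs]] := @dickson _ gs (fun a => exists2 q, L q & so_val q = a).
  by move=> _ [q Lq <-]; apply/Qn/so_valP.
have [t et] : exists t : seq (subset_of Q), map (@so_val _ _) t = s /\ forall p, p \in t -> L p.
  elim: s sL {hs} => [|y s IH] sL; first by exists [::].
  have [|t [et tL]] := IH; first by move=> z zs; apply: sL; rewrite inE zs orbT.
  have [q Lq qy] := sL y (mem_head _ _).
  exists (q :: t); rewrite /= et qy; split=> // p.
  by rewrite inE => /orP[/eqP->|/tL].
exists t; split=> [|q Lq]; first exact: et.2.
have [|p ps hp] := hs (so_val q); first by exists q.
move: ps; rewrite -et.1 => /mapP[p' tp' ep]; exists p', (SubsetOf (nQ _ hp)); split=> //.
by apply: val_inj; rewrite /= ep subrK.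
Qed.

(** The classical argument by leading terms, with the exponents [q] such that [P]
meets [X^q g + <gs>] in the role of the ideal of leading coefficients: by
Dickson's lemma these exponents are multiples of finitely many, and lifts of
those to [P], together with generators of the intersection of [P] with [<gs>],
generate [P]. *)
Lemma noetherian_homogeneous M (gs : seq M) (P : graded_submodule M) :
  (forall y, y \in gs -> exists b, gm_comp b y) -> (forall x, P x -> spanned gs x) ->
  exists s : seq M, (forall y, y \in s -> P y) /\ (forall x, P x -> spanned s x).
Proof.
elim: gs P => [|g gs IH] P hgs hP.
  by exists [::]; split=> // x /hP.
have hgs' y (ys : y \in gs) : exists b, gm_comp b y by apply: hgs; rewrite inE ys orbT.
have [b hg] := hgs g (mem_head _ _).
pose X : subset_of Q -> R := monomial 1.
have [s [sL hs]] := dickson_Q (fun q => exists2 p, P p & spanned gs (p - X q *: g)).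
have [||||P' hP'] := @gs_intro _ _ _ M (fun x => P x /\ spanned gs x).
- by split; [apply: gs0 | apply: spanned0].
- by move=> x y [? ?] [? ?]; split; [apply: gsB | apply: spannedB].
- by move=> r x [? ?]; split; [apply: gsZ | apply: spannedZ].
- by move=> a x [? ?]; split; [apply: hcomp_gs | apply: hcomp_spanned].
have [|s' [sP' hs']] := IH P' hgs'; first by move=> x /hP'[].
have /choice[p hp] q : exists p, q \in s -> P p /\ spanned gs (p - X q *: g).
  have [/sL[p Pp hp]|_] := boolP (q \in s); last by exists 0.
  by exists p.
exists (map p s ++ s'); split=> [y|].
  by rewrite mem_cat => /orP[/mapP[q /hp[Pp _] ->]//|/sP'/hP'[]].
have sub' y : P' y -> spanned (map p s ++ s') y.
  by move/hs'; apply: spanned_sub => z; rewrite mem_cat orbC => ->.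
move=> x Px; rewrite (hcomp_sum x); apply: spanned_sum => a _.
have Pa : P (hcomp a x) by apply: hcomp_gs.
have [r] := hP _ Pa; move/(hcomp_spanned a hgs').
rewrite raddfB /= (hcomp_id (hcomp_deg a x)) -[in hcomp a (r *: g)](subrK b a).
rewrite (hcompZ_hom _ (r : regular_graded k Q) hg).
have [-> h|[q [c [_ ->]]] h] := homogeneous_monomial (hcomp_deg (a - b) (r : regular_graded k Q)).
  by apply/sub'/hP'; split=> //; rewrite scale0r subr0 in h.
have [c0|c0] := eqVneq c 0.
  by apply/sub'/hP'; split=> //; rewrite c0 monomial0 scale0r subr0 in h.
have [|q1 [q2 [sq1 eq]]] := hs q.
  exists ((monomial c^-1 0) *: hcomp a x); first exact: (gsZ (monomial c^-1 0) Pa).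
  have e : monomial c^-1 0 * monomial c q = X q by rewrite monomialM mulVf // add0r.
  by rewrite -e -scalerA -scalerBr; apply: spannedZ.
have [Pp hpq] := hp _ sq1.
rewrite -(subrK ((monomial c q2) *: p q1) (hcomp a x)); apply: spannedD.
  apply/sub'/hP'; split; first by apply: gsB => //; apply: gsZ.
  have e : monomial c q2 * X q1 = monomial c q by rewrite monomialM mulr1 -eq.
  have := spannedB h (spannedZ (monomial c q2) hpq).
  by rewrite scalerBr scalerA e opprB addrA subrK.
apply/spannedZ/spanned_mem; rewrite mem_cat; apply/orP; left; exact: map_f.
Qed.

Lemma noetherian M (P : graded_submodule M) :
  finitely_generated M -> finitely_generated (sub_graded P).
Proof.
move=> /fg_homogeneous[gs [hgs hs]].
have [|s [sP hs']] := noetherian_homogeneous (P := P) hgs; first by move=> x _.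
exact: spanned_val sP hs'.
Qed.

(** Otherwise a strictly increasing sequence of members of [F] could be chosen;
its union is finitely generated, hence reached at a finite stage. *)
Lemma maximal_submodule M (F : graded_submodule M -> Prop) (P0 : graded_submodule M) :
  finitely_generated M -> F P0 ->
  exists2 P : graded_submodule M, F P &
    forall P' : graded_submodule M, F P' -> (forall x, P x -> P' x) -> forall x, P' x -> P x.
Proof.
move=> Mfg F0; apply: contrapT => nmax.
have step (P : {P | F P}) : exists P' : {P | F P},
    (forall x, sval P x -> sval P' x) /\ exists x, sval P' x /\ ~ sval P x.
  case: P => P FP /=; apply: contrapT => nP; apply: nmax; exists P => // P' FP' PP' x P'x.
  by apply: contrapT => nPx; apply: nP; exists (exist _ P' FP'); split=> //=; exists x.
have [next hnext] := choice step.
pose c n := iter n next (exist _ P0 F0).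
have cmono m n x : (m <= n)%N -> sval (c m) x -> sval (c n) x.
  move=> /subnK <- h; elim: (n - m)%N => //= j IHj; exact: (hnext _).1.
have [||||U hU] := @gs_intro _ _ _ M (fun x => exists n, sval (c n) x).
- by exists 0%N; apply: gs0.
- move=> x y [m hx] [n hy]; exists (maxn m n); apply: gsB.
    exact: cmono (leq_maxl _ _) hx.
  exact: cmono (leq_maxr _ _) hy.
- by move=> r x [n hx]; exists n; apply: gsZ.
- by move=> a x [n hx]; exists n; apply: hcomp_gs.
have [s [sU hs]] := val_spanned (noetherian U Mfg).
have [n hn] : exists n, forall y, y \in s -> sval (c n) y.
  elim: s sU {hs} => [|y s IH] sU; first by exists 0%N.
  have [|n hn] := IH; first by move=> z zs; apply: sU; rewrite inE zs orbT.
  have /hU[m hm] := sU y (mem_head _ _); exists (maxn m n) => z.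
  rewrite inE => /orP[/eqP->|/hn]; first exact: cmono (leq_maxl _ _) hm.
  exact/cmono/leq_maxr.
have [_ [x [hx []]]] := hnext (c n).
have /hs : U x by apply/hU; exists n.+1.
elim: s {sU hs} hn x {hx} => /= [|y s IH] hn x; first by move=> ->; apply: gs0.
move=> [r /IH h]; rewrite -(subrK (r *: y) x); apply: gsD.
  by apply: h => z zs; apply: hn; rewrite inE zs orbT.
by apply/gsZ/hn/mem_head.
Qed.

End Noetherian.

(** * Injective objects among the Q-graded modules *)

Section QInjective.
Variables (k : fieldType) (d : nat) (Q : addrClosed 'rV[int]_d).
Local Notation R := (semigroup_ring k Q).
Local Notation deg := 'rV[int]_d.
Implicit Types (M N W : graded_module k Q) (a b : deg) (p q s t : subset_of Q).

Definition Qgraded M : Prop := forall a (x : M), gm_comp a x -> a \notin Q -> x = 0.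

(** Only Q-graded targets [B] are tested: an object that is injective among all
graded modules is usually not finitely generated. *)
Definition Qinjective W : Prop :=
  forall (A B : graded_module k Q) (i : graded_hom A B) (f : graded_hom A W),
    Qgraded B -> injective i -> exists g : graded_hom B W, forall x, g (i x) = f x.

Lemma so_valD p q : so_val (p + q) = so_val p + so_val q. Proof. by []. Qed.

Lemma deg_cases a : a \notin Q \/ exists q, so_val q = a.
Proof.
have [aQ|] := boolP (a \in Q); last by left.
by right; exists (SubsetOf aQ).
Qed.

Lemma so_val_inj p q : so_val p = so_val q -> p = q.
Proof. exact: val_inj. Qed.

Lemma so_addIr q p1 p2 : p1 + q = p2 + q -> p1 = p2.
Proof. by move=> /(congr1 (@so_val _ _)); rewrite !so_valD => /addIr /so_val_inj. Qed.

Lemma gh_eq M N (f g : {linear M -> N}) :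
  (forall a x, gm_comp a x -> f x = g x) -> forall x, f x = g x.
Proof.
move=> fg x; rewrite (hcomp_sum x) !raddf_sum; apply: eq_bigr => a _.
exact: fg (hcomp_deg a x).
Qed.

Lemma gh_linear M N (f : graded_hom M N) (r : R) x y : f (x + r *: y) = f x + r *: f y.
Proof. by rewrite raddfD /= linearZ. Qed.

Lemma ghZ M N (f : graded_hom M N) (r : R) x : f (r *: x) = r *: f x.
Proof. exact: linearZ. Qed.

Lemma gh0 M N (f : graded_hom M N) : f 0 = 0.
Proof. exact: raddf0. Qed.

(** [W] is the module [k{T}], with [e q] the basis vector in degree [q] when [q]
lies in [T] and 0 otherwise. *)
Record is_trunc (T : subset_of Q -> Prop) W (e : subset_of Q -> W) : Prop := IsTrunc {
  trunc_fg : finitely_generated W;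
  trunc_Qgraded : Qgraded W;
  tgen_deg : forall q, gm_comp (so_val q) (e q);
  tgen_shift : forall c p q, monomial c p *: e q = monomial c 0 *: e (p + q);
  tgen_out : forall q, ~ T q -> e q = 0;
  tgen_free : forall c q, T q -> monomial c 0 *: e q = 0 -> c = 0;
  tgen_span : forall q w, gm_comp (so_val q) w -> exists c, w = monomial c 0 *: e q }.

(** When [T] is a down-set, the monomials outside [T] span an ideal, and [k{T}] is
the quotient by it. *)
Section TruncationExists.
Variable T : subset_of Q -> Prop.
Hypothesis Tdown : forall q s, T (q + s) -> T s.
Definition trunc_mem (r : regular_graded k Q) : Prop := forall q, T q -> (r : R)@_q = 0.

Lemma trunc_memB x y : trunc_mem x -> trunc_mem y -> trunc_mem (x - y).
Proof. by move=> hx hy q Tq; rewrite mcoeffB hx // hy // subr0. Qed.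

Lemma trunc_memZ (r : R) x : trunc_mem x -> trunc_mem (r *: x).
Proof.
move=> hx q Tq; rewrite -[r *: x]/(r * (x : R)).
rewrite (monomial_sum r) (monomial_sum x) mulr_suml raddf_sum big1 //= => p1 _.
rewrite mulr_sumr raddf_sum big1 //= => p2 _.
rewrite monomialM coef_monomial; case: eqP => // e.
by rewrite hx ?mulr0 //; apply: (Tdown (q := p1)); rewrite e.
Qed.

(** The coefficients of [x] are distributed among its homogeneous components, so a
condition on coefficients passes to components. *)
Lemma trunc_mem_span (x : regular_graded k Q) : trunc_mem x -> hspan trunc_mem x.
Proof.
move=> hx; exists (hsupp x), (fun a => hcomp a x); split; last exact: hcomp_sum.
move=> a; split; first exact: hcomp_deg.
move=> q Tq; have [e|e] := eqVneq (so_val q) a; last first.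
  by apply/eqP; apply: contraNT e => /(hcomp_deg a x) ->.
have := hx q Tq; rewrite {1}(hcomp_sum x).
have [ax|ax] := boolP (a \in hsupp x); last by rewrite (hcomp_out ax) mcoeff0.
rewrite raddf_sum (bigD1_seq a) ?hsupp_uniq //= big1 ?addr0 // => b ba.
by apply/eqP; apply: contraNT ba => /(hcomp_deg b x) <-; rewrite e.
Qed.

Lemma trunc_mem0 : trunc_mem 0.
Proof. by move=> q _; rewrite mcoeff0. Qed.

Definition trunc_ideal : graded_ideal k Q :=
  @GradedSubmodule _ _ _ (regular_graded k Q) trunc_mem
    trunc_mem0 trunc_memB trunc_memZ trunc_mem_span.

Lemma regular_fg : finitely_generated (regular_graded k Q).
Proof. by exists 1%N, (fun=> 1) => x; exists (fun=> x); rewrite big_ord1 -[RHS]/(x * 1 : R) mulr1. Qed.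

Lemma trunc_exists : exists W (e : subset_of Q -> W), is_trunc T e.
Proof.
have scaleE c p q : monomial c p *: quot_pi trunc_ideal (monomial 1 q : R^o) =
    quot_pi trunc_ideal (monomial c (p + q) : R^o).
  rewrite -linearZ; congr (quot_pi _ _).
  by rewrite -[LHS]/(monomial c p * monomial 1 q) monomialM mulr1.
exists (quot_graded trunc_ideal), (fun q => quot_pi trunc_ideal (monomial 1 q : R^o)); split.
- apply: (fg_surj (f := quot_pi trunc_ideal)) regular_fg => y.
  by exists (repr y); rewrite [RHS]quot_piK.
- move=> a w [x /homogeneous_monomial[->|[p [c [<- _]]]] ->]; first by rewrite raddf0.
  by rewrite so_valP.
- by move=> q; exists (monomial 1 q : R^o) => //; apply: monomial_deg.
- by move=> c p q; rewrite !scaleE add0r.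
- move=> q nT; rewrite -(raddf0 (quot_pi trunc_ideal)); apply/quot_piP.
  move=> p Tp; rewrite subr0 coef_monomial; case: eqP => // e.
  by rewrite e in nT.
- move=> c q Tq; rewrite scaleE add0r -(raddf0 (quot_pi trunc_ideal)) => /quot_piP /(_ q Tq).
  by rewrite subr0 coef_monomial eqxx.
- move=> q w [x /homogeneous_monomial[->|[p [c [/so_val_inj -> ->]]]] ->].
    by exists 0; rewrite monomial0 scale0r raddf0.
  by exists c; rewrite scaleE add0r.
Qed.

End TruncationExists.

Section Truncation.
Variable T : subset_of Q -> Prop.
Hypothesis Tdown : forall q s, T (q + s) -> T s.
Hypothesis Tdir : forall p q, T p -> T q -> exists u v, u + p = v + q /\ T (u + p).

Variables (W : graded_module k Q) (tgen : subset_of Q -> W).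
Hypothesis We : is_trunc T tgen.

Section Extension.
Variable B : graded_module k Q.
Hypothesis BQ : Qgraded B.

(** [G s x c] says that the functional takes the value [c] at [x], of degree [s].
The axioms make [G] the graph of a partially defined linear functional on the
colimit of the pieces of [B] of degree in [T]; a total one is the same thing as
a graded map from [B] to [k{T}].  Graphs rather than functions are used so that
unions of chains are immediate. *)
Definition functional (G : subset_of Q -> B -> k -> Prop) : Prop :=
  [/\ forall s x c, G s x c -> T s /\ gm_comp (so_val s) x,
      forall s, T s -> G s 0 0,
      forall s x y c e u, G s x c -> G s y e -> G s (x + monomial u 0 *: y) (c + u * e),
      forall s q x c, T (q + s) -> G s x c -> G (q + s) (monomial 1 q *: x) c
    & forall s c, G s 0 c -> c = 0].

Lemma functionalZ G s x c u : functional G -> G s x c -> G s (monomial u 0 *: x) (u * c).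
Proof.
move=> [Gd G0 Gl _ _] h; rewrite -[_ *: x]add0r -[u * c]add0r; apply: Gl => //.
by apply: G0; case: (Gd _ _ _ h).
Qed.

Lemma functional_uniq G s x c e : functional G -> G s x c -> G s x e -> c = e.
Proof.
move=> GF h1 h2; have [_ _ Gl _ Gz] := GF.
have := Gl _ _ _ _ _ (-1) h1 h2; rewrite mulN1r => h.
apply/eqP; rewrite -subr_eq0; apply/eqP; apply: (Gz s); move: h.
suff -> : monomial (-1) 0 = -1 :> R by rewrite scaleN1r subrr.
apply/eqP; rewrite -addr_eq0 -monomial1 -monomialD addrC subrr.
by rewrite monomial0.
Qed.

(** The value at [b] is forced as soon as some multiple [X^q b], with [q + s] in
[T], is in the domain.  Two such multiples force the same value, because they
have a common multiple of degree in [T]; this is where directedness enters.  If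
no multiple of [b] is in the domain, any value would do. *)
Lemma functional_extend1 G s (b : B) : functional G -> T s -> gm_comp (so_val s) b ->
  exists G', [/\ functional G', forall t x c, G t x c -> G' t x c & exists c, G' s b c].
Proof.
move=> GF Ts hb; have [Gd G0 Gl Gs Gz] := GF.
(* c0 is the value to be given to b *)
have [c0 hc0] : exists c0, forall q c, T (q + s) -> G (q + s) (monomial 1 q *: b) c -> c = c0.
  have [[q [c [Tq hq]]]|nq] := pselect (exists q c, T (q + s) /\ G (q + s) (monomial 1 q *: b) c).
    exists c => q' c' Tq' hq'; have [u [v [e Tu]]] := Tdir Tq Tq'.
    have h1 := Gs _ _ _ _ Tu hq.
    rewrite e in Tu; have h2 := Gs _ _ _ _ Tu hq'.
    rewrite !addrA in e; have {}e' := so_addIr e.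
    move: h1 h2; rewrite !scalerA !monomialM mul1r e' !addrA e => h1 h2.
    exact: functional_uniq GF h2 h1.
  by exists 0 => q c Tq h; case: nq; exists q, c.
pose G' t x c := G t x c \/ exists q y e u,
  [/\ t = q + s, T t, G t y e, x = y + monomial u q *: b & c = e + u * c0].
have G'n t x c q : t = q + s -> G' t x c -> exists y e u,
    [/\ T t, G t y e, x = y + monomial u q *: b & c = e + u * c0].
  move=> et [h|[q' [y [e [u [et' Tt h -> ->]]]]]].
    exists x, c, 0; split=> //; first by case: (Gd _ _ _ h).
      by rewrite monomial0 scale0r addr0.
    by rewrite mul0r addr0.
  by rewrite et in et'; rewrite (so_addIr et'); exists y, e, u.
exists G'; split; last 2 first.
- by move=> t x c h; left.
- exists c0; right; exists 0, 0, 0, 1; split=> //; rewrite ?add0r ?mul1r ?monomial1 ?scale1r //.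
  exact: G0.
split.
- move=> t x c [/Gd//|[q [y [e [u [et Tt h -> _]]]]]]; split=> //.
  apply: gm_compD; first by have [] := Gd _ _ _ h.
  by rewrite et; apply: gm_compZ => //; apply: monomial_deg.
- by move=> t Tt; left; apply: G0.
- move=> t x y c e u hx hy.
  have [[q et]|nq] := pselect (exists q, t = q + s).
    have [x' [c' [u1 [Tt h1 -> ->]]]] := G'n _ _ _ _ et hx.
    have [y' [e' [u2 [_ h2 -> ->]]]] := G'n _ _ _ _ et hy.
    right; exists q, (x' + monomial u 0 *: y'), (c' + u * e'), (u1 + u * u2); split=> //.
    + exact: Gl.
    + by rewrite scalerDr scalerA monomialM add0r monomialD scalerDl addrACA.
    + by rewrite mulrDr mulrDl mulrA addrACA.
  case: hx => [hx|[q [? [? [? [et _ _ _ _]]]]]]; last by case: nq; exists q.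
  case: hy => [hy|[q [? [? [? [et _ _ _ _]]]]]]; last by case: nq; exists q.
  by left; apply: Gl.
- move=> t q x c Tqt [h|[q' [y [e [u [et Tt h -> ->]]]]]]; first by left; apply: Gs.
  right; exists (q + q'), (monomial 1 q *: y), e, u; split=> //.
  + by rewrite et addrA.
  + exact: Gs.
  + by rewrite scalerDr scalerA monomialM mul1r.
- move=> t c [/Gz//|[q [y [e [u [et Tt h ey ->]]]]]].
  have [u0|u0] := eqVneq u 0.
    move: ey; rewrite u0 monomial0 scale0r addr0 mul0r addr0 => ey.
    by rewrite -ey in h; apply: (Gz _ _ h).
  have h' := functionalZ (- u^-1) GF h.
  have ey' : monomial (- u^-1) 0 *: y = monomial 1 q *: b.
    have -> : y = - (monomial u q *: b) by apply/eqP; rewrite -addr_eq0 -ey.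
    rewrite -scaleNr scalerA.
    have -> : - monomial u q = monomial (- u) q.
      by apply/eqP; rewrite eq_sym -addr_eq0 -monomialD addrC subrr monomial0.
    by rewrite monomialM mulrNN mulVf // add0r.
  rewrite ey' et in h'; rewrite et in Tt; rewrite -(hc0 _ _ Tt h').
  by rewrite mulrA mulrN divff // mulN1r subrr.
Qed.

Lemma functional_total G0 : functional G0 -> exists G, [/\ functional G,
  forall t x c, G0 t x c -> G t x c
  & forall t x, T t -> gm_comp (so_val t) x -> exists c, G t x c].
Proof.
move=> F0; pose Z := {G | functional G /\ forall t x c, G0 t x c -> G t x c}.
pose le (G H : Z) := `[< forall t x c, sval G t x c -> sval H t x c >].
have [|||G mG] := @classical_sets.ZL_preorder Z (exist _ G0 (conj F0 (fun _ _ _ h => h))) le.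
- by move=> G; apply/asboolP.
- by move=> G H K /asboolP GH /asboolP HK; apply/asboolP => t x c /GH/HK.
- move=> A totA; have [[G1 AG1]|nA] := pselect (exists G, A G); last first.
    exists (exist _ G0 (conj F0 (fun _ _ _ h => h))) => G AG; case: nA.
    by exists G.
  pose U t x c := exists2 G, A G & sval G t x c.
  have UF : functional U; first split.
  + by move=> t x c [G _ h]; have [[Gd _ _ _ _] _] := svalP G; apply: Gd h.
  + by move=> t Tt; exists G1 => //; have [[_ h _ _ _] _] := svalP G1; apply: h.
  + move=> t x y c e u [G AG hx] [H AH hy].
    have [/asboolP GH|/asboolP HG] := totA _ _ AG AH.
      by exists H => //; have [[_ _ h _ _] _] := svalP H; apply: h => //; apply: GH.
    by exists G => //; have [[_ _ h _ _] _] := svalP G; apply: h => //; apply: HG.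
  + move=> t q x c Tq [G AG h]; exists G => //.
    by have [[_ _ _ hs _] _] := svalP G; apply: hs.
  + by move=> t c [G AG h]; have [[_ _ _ _ hz] _] := svalP G; apply: hz h.
  have U0 t x c : G0 t x c -> U t x c.
    by move=> h; exists G1 => //; have [_] := svalP G1; apply.
  exists (exist _ U (conj UF U0)) => G AG; apply/asboolP => t x c h.
  by exists G.
have [GF G0G] := svalP G; exists (sval G); split=> // t x Tt hx.
have [G' [GF' GG' [c hc]]] := functional_extend1 GF Tt hx.
have G0G' t' x' c' (h : G0 t' x' c') : G' t' x' c' by apply/GG'/G0G.
exists c; have /asboolP := mG (exist _ G' (conj GF' G0G')) (introT (asboolP _) GG').
exact.
Qed.

Lemma trunc_extension G0 : functional G0 ->
  exists g : graded_hom B W, forall s x c, G0 s x c -> g x = monomial c 0 *: tgen s.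
Proof.
move=> /functional_total[G [GF G0G tot]]; have [Gd GZ0 Gl Gs Gz] := GF.
have /choice[la hla] (p : subset_of Q * B) : exists c, T p.1 ->
    gm_comp (so_val p.1) p.2 -> G p.1 p.2 c.
  have [[Tp hp]|np] := pselect (T p.1 /\ gm_comp (so_val p.1) p.2).
    by have [c hc] := tot _ _ Tp hp; exists c.
  by exists 0 => Tp hp; case: np.
have laE s x c : G s x c -> la (s, x) = c.
  move=> h; have [Ts hx] := Gd _ _ _ h.
  exact: functional_uniq GF (hla (s, x) Ts hx) h.
pose phi a x : W := if insub a is Some q then monomial (la (q, x)) 0 *: tgen q else 0.
have phiE q x : phi (so_val q) x = monomial (la (q, x)) 0 *: tgen q.
  by rewrite /phi (valK q).
have phiN a x : a \notin Q -> phi a x = 0.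
  by move=> aQ; rewrite /phi insubN.
have phi0 a : phi a 0 = 0.
  have [/phiN->//|[q <-]] := deg_cases a; rewrite phiE.
  have [Tq|/(tgen_out We) ->] := pselect (T q); last by rewrite scaler0.
  by rewrite (laE _ _ _ (GZ0 _ Tq)) monomial0 scale0r.
have [|||g hg] := @gh_extend _ _ _ B W phi.
- move=> a x hx; have [/phiN->|[q <-]] := deg_cases a; first exact: gm_comp0.
  rewrite phiE -[so_val q]add0r; apply: gm_compZ; last exact: (tgen_deg We).
  exact: monomial_deg.
- move=> a x y; have [aQ|[q <-]] := deg_cases a; first by rewrite !phiN // addr0.
  rewrite !phiE => hx hy.
  have [Tq|/(tgen_out We) ->] := pselect (T q); last by rewrite !scaler0 addr0.
  have := Gl _ _ _ _ _ 1 (hla (q, x) Tq hx) (hla (q, y) Tq hy).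
  by rewrite monomial1 scale1r mul1r => /laE ->; rewrite monomialD scalerDl.
- move=> a q c x; have [aQ hx|[s <-] hx] := deg_cases a.
    by rewrite (BQ hx aQ) !scaler0 !phi0 scaler0.
  rewrite -so_valD !phiE scalerA monomialM (addr0 q) (tgen_shift We _ q).
  have [Tq|/(tgen_out We) ->] := pselect (T (q + s)); last by rewrite !scaler0.
  have Ts := Tdown Tq.
  have := functionalZ c GF (Gs _ _ _ _ Tq (hla (s, x) Ts hx)).
  by rewrite scalerA monomialM mulr1 add0r => /laE ->.
exists g => s x c /G0G h; have [_ hx] := Gd _ _ _ h.
by rewrite (hg _ _ hx) phiE (laE _ _ _ h).
Qed.

End Extension.

(** A map from [A] to [k{T}] is a functional on the image of [A] in [B]. *)
Lemma trunc_Qinjective : Qinjective W.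
Proof.
move=> A B i f BQ ii.
pose G0 s (y : B) c := T s /\ exists x,
  [/\ gm_comp (so_val s) x, y = i x & f x = monomial c 0 *: tgen s].
have F0 : functional G0; first split.
- by move=> s _ c [Ts [x [hx -> _]]]; split=> //; apply: gh_deg.
- move=> s Ts; split=> //; exists 0; rewrite !gh0 monomial0 scale0r; split=> //.
  exact: gm_comp0.
- move=> s _ _ c c' u [Ts [x [hx -> fx]]] [_ [y [hy -> fy]]]; split=> //.
  exists (x + monomial u 0 *: y); split.
  + apply: gm_compD => //; rewrite -[so_val s]add0r; apply: gm_compZ => //.
    exact: monomial_deg.
  + by rewrite gh_linear.
  + rewrite gh_linear fx fy scalerA monomialM (addr0 (0 : subset_of Q)).
    by rewrite monomialD scalerDl.
- move=> s q _ c Tq [Ts [x [hx -> fx]]]; split=> //.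
  exists (monomial 1 q *: x); split.
  + by apply: gm_compZ => //; apply: monomial_deg.
  + by rewrite ghZ.
  + by rewrite ghZ fx scalerA monomialM mul1r (addr0 q) (tgen_shift We).
- move=> s c [Ts [x [hx ix fx]]].
  have x0 : x = 0 by apply: ii; rewrite gh0.
  by apply: (tgen_free We Ts); rewrite -fx x0 gh0.
have [g hg] := trunc_extension BQ F0; exists g.
have [h hh] : exists h : graded_hom A W, forall x, h x = g (i x).
  apply: gh_intro; first by move=> r x y; rewrite !linearP.
  by move=> a x hx; apply/gh_deg/gh_deg.
suff eq : forall x, h x = f x by move=> x; rewrite -hh.
apply: gh_eq => a x hx; have [aQ|[q aq]] := deg_cases a.
  by rewrite (trunc_Qgraded We (gh_deg h hx)) // (trunc_Qgraded We (gh_deg f hx)).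
rewrite -aq in hx; have [c fx] := tgen_span We (gh_deg f hx).
have [c' he] := tgen_span We (gh_deg h hx).
have [Tq|nT] := pselect (T q); last by rewrite fx he (tgen_out We) ?scaler0.
rewrite hh (hg q _ c) //; split=> //; by exists x.
Qed.

End Truncation.

Section Product.
Variables M N : graded_module k Q.

Definition prod_comp a (x : M * N) : Prop := gm_comp a x.1 /\ gm_comp a x.2.

Lemma pair_sum (J : Type) (s : seq J) (F : J -> (M * N)%type) :
  \sum_(j <- s) F j = (\sum_(j <- s) (F j).1, \sum_(j <- s) (F j).2).
Proof.
elim: s => [|j s IH]; first by rewrite !big_nil.
by rewrite !big_cons IH; case: (F j).
Qed.

Lemma prod_comp0 a : prod_comp a 0. Proof. by split; apply: gm_comp0. Qed.

Lemma prod_compB a x y : prod_comp a x -> prod_comp a y -> prod_comp a (x - y).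
Proof. by move=> [? ?] [? ?]; split; apply: gm_compB. Qed.

Lemma prod_compZ a b (r : R) x :
  homogeneous a r -> prod_comp b x -> prod_comp (a + b) (r *: x).
Proof. by move=> hr [? ?]; split; apply: gm_compZ. Qed.

Lemma prod_span (x : M * N) : exists (s : seq deg) (f : deg -> (M * N)%type),
  (forall a, prod_comp a (f a)) /\ x = \sum_(a <- s) f a.
Proof.
exists (undup (hsupp x.1 ++ hsupp x.2)), (fun a => (hcomp a x.1, hcomp a x.2)); split.
  by move=> a; split; apply: hcomp_deg.
case: x => y z; rewrite pair_sum /= {1}(hcomp_sum y) {1}(hcomp_sum z).
by congr pair; apply/esym/sum_widen; rewrite ?undup_uniq ?hsupp_uniq // => a;
  rewrite ?mem_undup ?mem_cat => /= h; rewrite ?h ?orbT //; apply: hcomp_out.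
Qed.

Lemma prod_indep (s : seq deg) (f : deg -> (M * N)%type) :
  uniq s -> (forall a, prod_comp a (f a)) -> \sum_(a <- s) f a = 0 ->
  forall a, a \in s -> f a = 0.
Proof.
move=> us hf; rewrite pair_sum => -[e1 e2] a sa.
have := gm_indep us (fun a => (hf a).1) e1 sa; have := gm_indep us (fun a => (hf a).2) e2 sa.
by case: (f a) => y z /= -> ->.
Qed.

Definition prod_graded : graded_module k Q :=
  @GradedModule _ _ _ (M * N)%type prod_comp prod_comp0 prod_compB prod_compZ
    prod_span prod_indep.

Lemma prod_Qgraded : Qgraded M -> Qgraded N -> Qgraded prod_graded.
Proof.
move=> MQ NQ a [x y] [/= hx hy] aQ.
by rewrite (MQ a x hx aQ) (NQ a y hy aQ).
Qed.

Lemma gh_pair A (f : graded_hom A M) (g : graded_hom A N) :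
  exists h : graded_hom A prod_graded, forall x, h x = (f x, g x).
Proof.
apply: gh_intro; first by move=> r x y; rewrite !linearP.
by move=> a x hx; split; apply: gh_deg.
Qed.

Lemma gh_fst : exists h : graded_hom prod_graded M, forall x, h x = x.1.
Proof. by apply: gh_intro => [//|a x []]. Qed.

Lemma gh_snd : exists h : graded_hom prod_graded N, forall x, h x = x.2.
Proof. by apply: gh_intro => [//|a x []]. Qed.

Lemma prod_Qinjective : Qinjective M -> Qinjective N -> Qinjective prod_graded.
Proof.
move=> MI NI A B i f BQ ii.
have [p1 hp1] := gh_fst; have [p2 hp2] := gh_snd.
have [f1 hf1] := gh_comp p1 f; have [f2 hf2] := gh_comp p2 f.
have [g1 hg1] := MI _ _ i f1 BQ ii; have [g2 hg2] := NI _ _ i f2 BQ ii.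
have [g hg] := gh_pair g1 g2; exists g => x.
by rewrite hg hg1 hg2 hf1 hf2 hp1 hp2; case: (f x).
Qed.

Lemma prod_fg : finitely_generated M -> finitely_generated N -> finitely_generated prod_graded.
Proof.
move=> /fgP[s hs] /fgP[t ht].
have [i1 h1] : exists h : graded_hom M prod_graded, forall x, h x = (x, 0).
  apply: gh_intro; last by move=> a x hx; split=> //; apply: gm_comp0.
  by move=> r x y; apply/pair_equal_spec; rewrite /= scaler0 addr0.
have [i2 h2] : exists h : graded_hom N prod_graded, forall x, h x = (0, x).
  apply: gh_intro; last by move=> a x hx; split=> //; apply: gm_comp0.
  by move=> r x y; apply/pair_equal_spec; rewrite /= scaler0 addr0.
apply/fgP; exists (map i1 s ++ map i2 t) => -[x y].
have -> : (x, y) = i1 x + i2 y.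
  by rewrite h1 h2; apply/pair_equal_spec; rewrite /= addr0 add0r.
apply: spannedD.
  apply: (spanned_sub _ (spanned_map i1 (hs x))) => z zs.
  by rewrite mem_cat zs.
apply: (spanned_sub _ (spanned_map i2 (ht y))) => z zs.
by rewrite mem_cat zs orbT.
Qed.

End Product.

End QInjective.

(** * Embedding into a finitely generated injective object *)

Section Embedding.
Variables (k : fieldType) (d : nat) (Q : addrClosed 'rV[int]_d).
Local Notation R := (semigroup_ring k Q).
Local Notation deg := 'rV[int]_d.
Implicit Types (M N W : graded_module k Q) (a b : deg) (p q s t : subset_of Q).
Hypothesis hQ : affine_semigroup Q.

(** Intersections of finitely many kernels of maps to modules [k{T}] are of this
form, since finite products of injective objects are injective. *)
Definition Qinjective_kernel M (P : M -> Prop) : Prop :=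
  exists W (j : graded_hom M W), [/\ finitely_generated W, Qgraded W, Qinjective W
    & forall x, j x = 0 <-> P x].

Lemma colon_exists M (P : graded_submodule M) a (x : M) : gm_comp a x ->
  exists J : graded_ideal k Q, forall r : R, J r <-> P (r *: x).
Proof.
move=> hx; apply: (@gs_intro _ _ _ (regular_graded k Q) (fun r => P ((r : R) *: x))).
- by rewrite scale0r; apply: gs0.
- by move=> r s hr hs; rewrite scalerBl; apply: gsB.
- by move=> r s hs; rewrite -[r *: s]/(r * (s : R)) -scalerA; apply: gsZ.
- by move=> b r hr; rewrite -(hcompZ_hom b r hx); apply: hcomp_gs.
Qed.

Lemma cyclic_exists M (P : graded_submodule M) a (x : M) : gm_comp a x ->
  exists P' : graded_submodule M, forall z, P' z <-> exists r : R, P (z - r *: x).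
Proof.
move=> hx; apply: (@gs_intro _ _ _ M (fun z => exists r : R, P (z - r *: x))).
- by exists 0; rewrite scale0r subr0; apply: gs0.
- move=> y z [r hr] [s hs]; exists (r - s); move: (gsB hr hs).
  by rewrite scalerBl !opprB [_ *: x - z]addrC addrACA [- _ + _]addrC.
- by move=> r z [s hs]; exists (r * s); rewrite -scalerA -scalerBr; apply: gsZ.
- move=> b z [r hr]; exists (hcomp (b - a) (r : regular_graded k Q)).
  by rewrite -(hcompZ_hom _ _ hx) subrK -raddfB; apply: hcomp_gs.
Qed.

(** Among the homogeneous elements of [M / P], one with a maximal annihilator has a
prime annihilator: if [X^q x] is nonzero, its annihilator contains that of [x],
so it is the same. *)
Lemma prime_element M (P : graded_submodule M) a0 (x0 : M) : gm_comp a0 x0 -> ~ P x0 ->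
  exists a (x : M), [/\ gm_comp a x, ~ P x
    & forall p q, ~ P (monomial 1 p *: x) -> ~ P (monomial 1 q *: x) ->
        ~ P (monomial 1 (p + q) *: x)].
Proof.
move=> hx0 Px0; have [J0 hJ0] := colon_exists P hx0.
have [|J [a [x [hx Px hJ]]] mJ] := @maximal_submodule _ _ _ hQ (regular_graded k Q)
  (fun J => exists a (x : M), [/\ gm_comp a x, ~ P x & forall r : R, J r <-> P (r *: x)])
  J0 (@regular_fg k d Q); first by exists a0, x0.
exists a, x; split=> // p q Pp Pq Ppq.
have hqx : gm_comp (so_val q + a) (monomial 1 q *: x).
  by apply: gm_compZ => //; apply: monomial_deg.
have [J' hJ'] := colon_exists P hqx.
have JJ' r : J r -> J' r.
  move/hJ => h; apply/hJ'; rewrite scalerA mulrC -scalerA; exact: gsZ.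
apply: Pp; apply/hJ; apply: (mJ J') => //; first by exists (so_val q + a), (monomial 1 q *: x).
by apply/hJ'; rewrite scalerA monomialM mulr1.
Qed.

(** Let [x], of degree [q0], have a prime annihilator modulo [P], and let [F] be
the set of exponents [q] such that [X^q x] is not in [P].  As [F] is closed
under addition, the down-set [T] generated by [F + q0] is directed, and [k{T}]
contains a copy of the submodule generated by [x] in [N / P].  The map from this
submodule to [k{T}] extends to [psi : N -> k{T}], whose kernel meets [P + R x]
only in [P].  Hence either [P] is the kernel of [psi], or it is the intersection
of the two strictly larger submodules [ker psi] and [P + R x]. *)
Lemma Qgraded_embedding_step N (P : graded_submodule N) : Qgraded N ->
  (forall P' : graded_submodule N, (forall x, P x -> P' x) -> (exists x, P' x /\ ~ P x) ->
     Qinjective_kernel P') -> Qinjective_kernel P.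
Proof.
move=> NQ IH.
have [full|/existsNP[z0 Pz0]] := pselect (forall x, P x).
  have [W [e We]] := @trunc_exists k d Q (fun=> False) (fun _ _ h => h).
  have [||j hj] := @gh_intro _ _ _ N W (fun=> 0).
  - by move=> r x y; rewrite scaler0 addr0.
  - by move=> a x _; apply: gm_comp0.
  exists W, j; split; first exact: trunc_fg We.
  - exact: trunc_Qgraded We.
  - by apply: (trunc_Qinjective _ _ We).
  - by move=> x; split=> [_|_]; [apply: full | apply: hj].
have [a0 [x0 [hx0 Px0]]] : exists a x, gm_comp a x /\ ~ P x.
  apply: contrapT => nx; apply: Pz0; rewrite (hcomp_sum z0); apply: gs_sum => a _.
  by apply: contrapT => Pa; apply: nx; exists a, (hcomp a z0); split=> //; apply: hcomp_deg.
have [a [x [hx Px prime]]] := prime_element hx0 Px0.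
have [aQ|[q0 aq0]] := deg_cases Q a; first by case: Px; rewrite (NQ a x hx aQ); apply: gs0.
rewrite -{}aq0 in hx => {a x0 a0 hx0 Px0 Pz0 z0}.
pose F q := ~ P (monomial 1 q *: x).
pose T t := exists f v, F f /\ v + t = f + q0.
have Tdown q s : T (q + s) -> T s.
  by move=> [f [v [Ff e]]]; exists f, (v + q); rewrite -addrA.
have Tdir s t : T s -> T t -> exists u v, u + s = v + t /\ T (u + s).
  move=> [f [v [Ff e]]] [f' [v' [Ff' e']]].
  exists (f' + v), (f + v'); rewrite -!addrA e e' [LHS]addrCA; split=> //.
  exists (f + f'), 0; split; first exact: prime.
  by rewrite add0r [LHS]addrCA addrA.
have TF r : T (r + q0) -> F r.
  move=> [f [v [Ff]]]; rewrite addrA => /so_addIr e; rewrite -e in Ff.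
  move=> Pr; apply: Ff; rewrite -[1]mulr1 -monomialM -scalerA; exact: gsZ.
have FT r : F r -> T (r + q0).
  by move=> Fr; exists r, 0; rewrite add0r.
have Pmono c r : P (monomial c r *: x) -> F r -> c = 0.
  move=> Pc Fr; apply/eqP/negPn/negP => c0; apply: Fr.
  have -> : monomial 1 r = monomial c^-1 0 * monomial c r by rewrite monomialM mulVf ?add0r.
  by rewrite -scalerA; apply: gsZ.
have [W [e We]] := @trunc_exists k d Q T Tdown.
have UQ : Qgraded (quot_graded P).
  by move=> a w [y hy ->] aQ; rewrite (NQ a y hy aQ) raddf0.
have [pi hpi] := gh_quot P.
have pi0 y : pi y = 0 <-> P y.
  by rewrite hpi -(raddf0 (quot_pi P)) -[in P y](subr0 y); apply: quot_piP.
move: (quot_graded P) pi pi0 UQ {hpi} => U pi pi0 UQ.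
(* the functional on the submodule generated by x that takes the value 1 at
   every X^r x with r in F *)
pose G0 t (y : U) c := T t /\ ((y = 0 /\ c = 0) \/
  exists r, t = r + q0 /\ y = monomial c r *: pi x).
have G0n t y c r : t = r + q0 -> G0 t y c -> y = monomial c r *: pi x.
  move=> et [_ [[-> ->]|[r' [et' ->]]]]; first by rewrite monomial0 scale0r.
  by rewrite et in et'; rewrite (so_addIr et').
have F0 : functional T G0; first split.
- move=> s y c [Ts [[-> _]|[r [er ->]]]]; first by split=> //; apply: gm_comp0.
  split=> //; rewrite er so_valD.
  by apply: gm_compZ; [apply: monomial_deg | apply: gh_deg].
- by move=> s Ts; split=> //; left.
- move=> s y z c c' u hy hz; have Ts := proj1 hy; split=> //.
  have [[r er]|nr] := pselect (exists r, s = r + q0).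
    right; exists r; split=> //; rewrite (G0n _ _ _ _ er hy) (G0n _ _ _ _ er hz).
    by rewrite scalerA monomialM add0r monomialD scalerDl.
  case: hy => _ [[-> ->]|[r [er _]]]; last by case: nr; exists r.
  case: hz => _ [[-> ->]|[r [er _]]]; last by case: nr; exists r.
  by left; rewrite scaler0 mulr0 !addr0.
- move=> s q y c Tq [Ts [[-> ->]|[r [er ->]]]]; split=> //.
    by left; rewrite scaler0.
  by right; exists (q + r); rewrite er addrA scalerA monomialM mul1r.
- move=> s c [Ts [[_ ->]//|[r [er]]]] /esym; rewrite -ghZ => /pi0 Pc.
  by apply: (Pmono _ _ Pc); apply: TF; rewrite -er.
have [g hg] := trunc_extension Tdown Tdir We UQ F0.
have [psi hpsi] := gh_comp g pi.
have psix c r : F r -> psi (monomial c r *: x) = monomial c 0 *: e (r + q0).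
  move=> Fr; rewrite hpsi; apply: hg; split; first exact: FT.
  by right; exists r; rewrite ghZ.
have WI := trunc_Qinjective Tdown Tdir We.
have psiP y : P y -> psi y = 0 by move=> /pi0 Py; rewrite hpsi Py gh0.
have [KP|/existsNP[y /not_implyP[Ky nPy]]] := pselect (forall y, psi y = 0 -> P y).
  exists W, psi; split=> //; [exact: trunc_fg We | exact: trunc_Qgraded We |].
  by move=> y; split; [apply: KP | apply: psiP].
have [||W1 [j1 [fg1 Q1 I1 h1]]] := IH (kernel psi).
- exact: psiP.
- by exists y.
have [P' hP'] := cyclic_exists P hx.
have [||W2 [j2 [fg2 Q2 I2 h2]]] := IH P'.
- by move=> z Pz; apply/hP'; exists 0; rewrite scale0r subr0.
- by exists x; split=> //; apply/hP'; exists 1; rewrite scale1r subrr; apply: gs0.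
have [j hj] := gh_pair j1 j2.
exists (prod_graded W1 W2), j; split.
- exact: prod_fg.
- exact: prod_Qgraded.
- exact: prod_Qinjective.
move=> z; rewrite hj; split=> [[/h1 Kz /h2/hP'[r Pzr]]|Pz]; last first.
  apply/pair_equal_spec; split; first by apply/h1/psiP.
  by apply/h2/hP'; exists 0; rewrite scale0r subr0.
have psir : psi (r *: x) = 0.
  by rewrite -[r *: x](subKr z) raddfB /= (psiP _ Pzr) [X in X - _]Kz subr0.
rewrite -(subrK (r *: x) z); apply: gsD => //.
(* both colon ideals of x, by the kernel of psi and by P, are graded, so it is
   enough to compare the monomials that they contain *)
have [J hJ] := colon_exists (kernel psi) hx.
have : J r by apply/hJ.
rewrite {2}(hcomp_sum (r : regular_graded k Q)) scaler_suml => Jr.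
apply: gs_sum => b _; have /hJ : J (hcomp b (r : regular_graded k Q)) by apply: hcomp_gs.
have [->|[q [c [_ ->]]]] := homogeneous_monomial (hcomp_deg b (r : regular_graded k Q)).
  by move=> _; rewrite scale0r; apply: gs0.
move=> Kc; apply: contrapT => nP.
have Fq : F q.
  move=> Pq; apply: nP; have -> : monomial c q = monomial c 0 * monomial 1 q.
    by rewrite monomialM mulr1 add0r.
  by rewrite -scalerA; apply: gsZ.
have c0 : c = 0 by apply: (tgen_free We (FT _ Fq)); rewrite -psix.
by apply: nP; rewrite c0 monomial0 scale0r; apply: gs0.
Qed.

Lemma Qgraded_embedding N : finitely_generated N -> Qgraded N ->
  exists W (j : graded_hom N W),
    [/\ finitely_generated W, Qgraded W, Qinjective W & injective j].
Proof.
move=> Nfg NQ; have [bad|] := pselect (exists P : graded_submodule N, ~ Qinjective_kernel P).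
  have [P0 F0] := bad.
  have [P nP mP] := maximal_submodule hQ (F := fun P => ~ Qinjective_kernel P) Nfg F0.
  case: nP; apply: Qgraded_embedding_step => // P' PP' [x [P'x nPx]].
  by apply: contrapT => nP'; apply: nPx; apply: (mP P').
move=> good; have : Qinjective_kernel (zero_submodule N).
  by apply: contrapT => h; apply: good; exists (zero_submodule N).
move=> [W [j [Wfg WQ WI hj]]]; exists W, j; split=> // x y jxy.
by apply/eqP; rewrite -subr_eq0; apply/eqP/hj; rewrite raddfB /= jxy subrr.
Qed.

End Embedding.

(** * Comparison with an arbitrary injective resolution *)

Section Staircase.
Variables (k : fieldType) (d : nat) (Q : addrClosed 'rV[int]_d).
Local Notation R := (semigroup_ring k Q).
Local Notation deg := 'rV[int]_d.
Implicit Types (M N W : graded_module k Q) (a b : deg).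

Lemma QpartP M (x : M) : Qpart M x <-> forall a, a \notin Q -> hcomp a x = 0.
Proof.
split=> [[s [f [sQ hf ->]]] a aQ|h].
  rewrite raddf_sum big_seq big1 //= => b /sQ bQ; apply: hcomp_neq (hf b) _.
  by apply: contraNneq aQ => ->.
rewrite (hcomp_sum x); apply: gs_sum => a _.
have [aQ|/h ->] := boolP (a \in Q); last exact: gs0.
exact: Qpart_hom aQ (hcomp_deg a x).
Qed.

Lemma Qpart_Qgraded M : Qgraded (sub_graded (Qpart M)).
Proof.
move=> a x hx aQ; apply: val_inj; rewrite raddf0 -(hcomp_id (hx : gm_comp a (val x))).
by have /QpartP := sub_memP x; apply.
Qed.

Lemma Qgraded_Qpart M N (f : graded_hom M N) x : Qgraded M -> Qpart N (f x).
Proof.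
move=> MQ; apply/QpartP => a aQ.
by rewrite hcomp_gh (MQ a _ (hcomp_deg a x) aQ) gh0.
Qed.

Lemma gh_incl M (P : graded_submodule M) :
  exists i : graded_hom (sub_graded P) M, forall x, i x = val x.
Proof. by apply: gh_intro => // r x y; rewrite linearP. Qed.

Lemma gh_corestrict M N (P : graded_submodule N) (f : graded_hom M N) :
  (forall x, P (f x)) -> exists g : graded_hom M (sub_graded P), forall x, val (g x) = f x.
Proof.
move=> Pf; have [||g hg] := @gh_intro _ _ _ M (sub_graded P) (fun x => sub_elt (Pf x)).
- by move=> r x y; apply: val_inj; rewrite [RHS]linearP; apply: linearP.
- by move=> a x hx; apply: (gh_deg f hx).
by exists g => x; rewrite hg.
Qed.

Variables (M : graded_module k Q) (E : injective_resolution M).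

Lemma Qcocycle_exists n : exists Z : graded_submodule (E n),
  forall x, Z x <-> cc_d E n x = 0 /\ Qpart (E n) x.
Proof.
apply: gs_intro.
- by split; [apply: gh0 | apply: gs0].
- move=> x y [hx Qx] [hy Qy]; split; last exact: gsB.
  by rewrite raddfB /= hx hy subr0.
- by move=> r x [hx Qx]; split; [rewrite ghZ hx scaler0 | apply: gsZ].
- by move=> a x [hx Qx]; split; [rewrite -hcomp_gh hx raddf0 | apply: hcomp_gs].
Qed.

Definition Qcocycle n : graded_submodule (E n) := sval (cid (Qcocycle_exists n)).

Lemma QcocycleP n x : Qcocycle n x <-> cc_d E n x = 0 /\ Qpart (E n) x.
Proof. exact: (svalP (cid (Qcocycle_exists n))). Qed.

(** Nullhomotopic in the single degree [n]: [delta] factors as [d \o h], and is 0 in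
degree 0, where there is nothing for [h] to map to. *)
Definition null_homotopic n : graded_hom (E n) (E n) -> Prop :=
  match n with
  | 0 => fun delta => forall x, delta x = 0
  | m.+1 => fun delta => exists h : graded_hom (E m.+1) (E m),
      forall x, delta x = cc_d E m (h x)
  end.

Definition fg_approximation n : Prop :=
  exists N (phi : graded_hom N (E n)) (gamma : graded_hom (sub_graded (Qcocycle n)) N)
      (delta : graded_hom (E n) (E n)),
    [/\ finitely_generated N /\ Qgraded N, forall y, cc_d E n (phi y) = 0,
        forall z, val z = phi (gamma z) + delta (val z) & null_homotopic delta].

Hypothesis hQ : affine_semigroup Q.
Hypothesis Mfg : finitely_generated M.

(** In degree 0 the Q-graded cocycles are exactly the Q-graded part of [M]. *)
Lemma fg_approximation0 : fg_approximation 0.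
Proof.
have [i hi] := gh_incl (Qpart M).
have [phi hphi] := gh_comp (ir_aug E) i.
have dphi y : cc_d E 0 (phi y) = 0.
  by apply/ir_exact0; exists (val y); rewrite hphi hi.
have NQ := @Qpart_Qgraded M.
have [p hp] : exists p : graded_hom (sub_graded (Qpart M)) (sub_graded (Qcocycle 0)),
    forall x, val (p x) = phi x.
  apply: gh_corestrict => x; apply/QcocycleP; split=> //.
  exact: Qgraded_Qpart.
have psurj z : exists y, z = p y.
  have /QcocycleP[/ir_exact0[y ey] /QpartP Qz] := sub_memP z.
  have Qy : Qpart M y.
    apply/QpartP => a aQ; apply: (@ir_aug_inj _ _ _ _ E).
    by rewrite gh0 -hcomp_gh -ey Qz.
  by exists (sub_elt Qy); apply: val_inj; rewrite hp hphi hi.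
have [id_ hid] : exists f : graded_hom (sub_graded (Qpart M)) (sub_graded (Qpart M)),
    forall x, f x = x by apply: gh_intro.
have [|gamma hgamma] := gh_factor (f := id_) psurj.
  move=> x px; rewrite hid; apply: val_inj; apply: (@ir_aug_inj _ _ _ _ E).
  by rewrite -(hi x) -(hi 0) !gh0 -hphi -hp px raddf0.
have [||delta hdelta] := @gh_intro _ _ _ (E 0) (E 0) (fun=> 0).
- by move=> r x y; rewrite scaler0 addr0.
- by move=> a x _; apply: gm_comp0.
exists (sub_graded (Qpart M)), phi, gamma, delta; split=> //.
- by split=> //; apply: noetherian.
- by move=> z; have [y ->] := psurj z; rewrite hgamma hid hdelta addr0 hp.
Qed.

Lemma null_homotopic_d n (delta : graded_hom (E n) (E n)) x :
  null_homotopic delta -> cc_d E n (delta x) = 0.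
Proof.
case: n delta x => [|n] delta x /=; first by move=> ->; apply: gh0.
by move=> [h ->]; apply: cc_dd.
Qed.

(** With [j : N -> W] the embedding, extend [phi] to [f : W -> E n] and [j \o gamma]
to [g : (E n)_Q -> W].  Then [d \o f] factors through [W / N], and [g] induces a
map from [(E n)_Q / Z n], that is from [Z n.+1], to [W / N].  The map
[id - f \o g - delta] kills [Z n], so it is [h \o d] for some [h] defined on
[Z n.+1], extended to [E n.+1] by injectivity of [E n]; this [h] is the next
homotopy. *)
Lemma fg_approximationS n : fg_approximation n -> fg_approximation n.+1.
Proof.
move=> [N [phi [gamma [delta [[Nfg NQ] dphi eqid null]]]]].
have [W [j [Wfg WQ WI ji]]] := Qgraded_embedding hQ Nfg NQ.
have [f hf] := @ir_injective _ _ _ _ E n _ _ j phi ji.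
have [c hc] := gh_incl (Qpart (E n)).
have [iZ hiZ] := gh_incl (Qcocycle n).
have [i hi] := gh_corestrict (P := Qpart (E n)) (f := iZ)
  (fun z => eq_ind _ (Qpart (E n)) ((QcocycleP (val z)).1 (sub_memP z)).2 _ (esym (hiZ z))).
have [jgamma hjgamma] := gh_comp j gamma.
have [|g hg] := WI _ _ i jgamma (@Qpart_Qgraded (E n)).
  by move=> x y ixy; apply: val_inj; rewrite -!hiZ -!hi ixy.
have [pi hpi] := gh_quot (Defs.image j).
have pi0 w : pi w = 0 <-> exists y, w = j y.
  by rewrite hpi -(raddf0 (quot_pi (Defs.image j))) -[in exists y, w = _](subr0 w); apply: quot_piP.
have pisurj u : exists w, u = pi w.
  by exists (repr u); rewrite hpi [RHS]quot_piK.
have [df hdf] := gh_comp (cc_d E n) f.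
have [|phi' hphi'] := gh_factor (f := df) pisurj.
  by move=> w /pi0[y ->]; rewrite hdf hf dphi.
have [dc hdc] := gh_comp (cc_d E n) c.
have [|p hp] := gh_corestrict (P := Qcocycle n.+1) (f := dc).
  move=> x; apply/QcocycleP; split; first by rewrite hdc; apply: cc_dd.
  exact/Qgraded_Qpart/Qpart_Qgraded.
have psurj z : exists x, z = p x.
  have /QcocycleP[/ir_exactS[y ey] /QpartP Qz] := sub_memP z.
  (* d y is Q-graded, so the Q-graded part y' of y has the same image *)
  pose y' := \sum_(a <- hsupp y | a \in Q) hcomp a y.
  have Qy : Qpart (E n) y'.
    by apply: Qpart_sum => a aQ; apply: Qpart_hom aQ (hcomp_deg a y).
  exists (sub_elt Qy); apply: val_inj; rewrite hp hdc hc /= ey (hcomp_sum y) /y'.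
  rewrite (bigID (mem Q)) /= raddfD /= [X in _ + X]raddf_sum [X in _ + X]big1 ?addr0 //= => a aQ.
  by rewrite -hcomp_gh -ey Qz.
have pker x : p x = 0 -> exists z, x = i z.
  move=> px; have Zx : Qcocycle n (val x).
    apply/QcocycleP; split; last exact: sub_memP.
    by rewrite -hc -hdc -hp px raddf0.
  by exists (sub_elt Zx); apply: val_inj; rewrite hi hiZ.
have [pig hpig] := gh_comp pi g.
have [|gamma' hgamma'] := gh_factor (f := pig) psurj.
  by move=> x /pker[z ->]; rewrite hpig hg hjgamma; apply/pi0; exists (gamma z).
have [q hq] : exists q : graded_hom (sub_graded (Qpart (E n))) (E n),
    forall x, q x = val x - f (g x) - delta (val x).
  apply: gh_intro.
    move=> r x y; rewrite !linearP /=. rewrite !scalerDr.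
    have ACA (A B C D F G : E n) : A + B + (C + D) + (F + G) = A + C + F + (B + D + G).
      by rewrite (addrACA A) (addrACA (A + C)).
    exact: ACA.
  move=> a x hx; apply: gm_compB; first apply: gm_compB => //.
    by do 2!apply: gh_deg.
  exact: gh_deg.
have [|h0 hh0] := gh_factor (f := q) psurj.
  move=> x /pker[z ->]; rewrite hq hg hjgamma hf hi hiZ.
  by rewrite {1}(eqid z) addrAC addrK subrr.
have [iZ' hiZ'] := gh_incl (Qcocycle n.+1).
have [|h hh] := @ir_injective _ _ _ _ E n _ _ iZ' h0.
  by move=> x y ixy; apply: val_inj; rewrite -!hiZ'.
have [delta' hdelta'] := gh_comp (cc_d E n) h.
exists (quot_graded (Defs.image j)), phi', gamma', delta'; split.
- split; first exact: (fg_surj pisurj Wfg).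
  by move=> a u [w hw ->] aQ; rewrite (WQ a w hw aQ) raddf0.
- move=> u; have [w ->] := pisurj u; rewrite hphi' hdf; exact: cc_dd.
- move=> z; have [x ->] := psurj z.
  rewrite hgamma' hpig hphi' hdf hdelta' -hiZ' hh hh0 hq hiZ' hp hdc hc.
  rewrite !raddfB /= null_homotopic_d // subr0.
  by rewrite addrC subrK.
by exists h.
Qed.

Lemma fg_approximation_exists n : fg_approximation n.
Proof. by elim: n => [|n]; [apply: fg_approximation0 | apply: fg_approximationS]. Qed.

(** The homotopy is linear, hence preserves torsion. *)
Lemma null_homotopic_coboundary (I : graded_ideal k Q) n (delta : graded_hom (E n) (E n))
    (z w : Gamma I (E n)) :
  null_homotopic delta -> val w = delta (val z) -> coboundaries (Gamma_complex I E) n w.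
Proof.
case: n delta z w => [|n] delta z w /=.
  by move=> h wz; apply: val_inj; rewrite [LHS]wz h raddf0.
by move=> [h hh] wz; exists (Gamma_hom I h z); apply: val_inj; rewrite [LHS]wz hh.
Qed.

(** The class of a torsion cocycle [z] of degree in [Q] is that of [phi (gamma z)],
because [z - phi (gamma z) = delta z] is the coboundary of a torsion element. *)
Lemma local_cohomology_Qpart_fg (I : graded_ideal k Q) n :
  finitely_generated (sub_graded (Qpart (local_cohomology I E n))).
Proof.
have [N [phi [gamma [delta [[Nfg NQ] dphi eqid null]]]]] := fg_approximation_exists n.
have [|kappa hkappa] := gh_corestrict (P := kernel (cc_d (Gamma_complex I E) n))
    (f := Gamma_hom I phi).
  by move=> y; apply: val_inj; rewrite /= dphi.
have [pi hpi] := gh_quot (sub_restrict (kernel (cc_d (Gamma_complex I E) n))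
    (coboundaries (Gamma_complex I E) n)).
have [psi hpsi] := gh_comp pi kappa.
have GQ : Qgraded (Gamma I N).
  move=> a y hy aQ; apply: val_inj; rewrite raddf0; exact: NQ hy aQ.
have [psi' hpsi'] := gh_corestrict (fun y => Qgraded_Qpart psi y GQ).
apply: (fg_surj (f := psi')) (noetherian hQ _ Nfg) => u.
suff [y ey] : exists y, val u = psi y by exists y; apply: val_inj; rewrite hpsi'.
have /QpartP Qu := sub_memP u.
have hom a (v : local_cohomology I E n) : a \in Q -> gm_comp a v -> exists y, v = psi y.
  move=> aQ [z hz ->].
  have Zz : Qcocycle n (val (val z)).
    apply/QcocycleP; split; last exact: (@Qpart_hom _ _ _ (E n) a _ aQ hz).
    by have := congr1 val (sub_memP z : Gamma_hom I (cc_d E n) (val z) = 0).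
  have Tz : torsion I (sub_graded (Qcocycle n)) (sub_elt Zz).
    have [m hm] := sub_memP (val z); exists m => r /hm rz; apply: val_inj.
    by rewrite linearZ raddf0.
  pose y := sub_elt (torsion_hom gamma Tz); exists y; rewrite hpsi hpi.
  apply/quot_piP.
  apply: (null_homotopic_coboundary null (z := val z)).
  have e1 : val (z - kappa y) = val z - val (kappa y) by exact: raddfB.
  have e2 : val (val z - val (kappa y)) = val (val z) - val (val (kappa y)).
    exact: raddfB.
  rewrite e1 e2 hkappa [X in _ - X]/=.
  by rewrite [X in X - _](eqid (sub_elt Zz)) addrC addKr.
rewrite (hcomp_sum (val u)); elim: (hsupp (val u)) => [|a s [y ey]].
  by exists 0; rewrite big_nil gh0.
rewrite big_cons ey; have [aQ|aQ] := boolP (a \in Q); last first.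
  by exists y; rewrite Qu // add0r.
have [y' ->] := hom a _ aQ (hcomp_deg a (val u)); exists (y' + y).
by rewrite raddfD.
Qed.

End Staircase.

Theorem corollary4p5 (k : fieldType) (d : nat) (Q : addrClosed 'rV[int]_d)
    (hQ : affine_semigroup Q) (I : graded_ideal k Q)
    (M : graded_module k Q) (hM : finitely_generated M)
    (E : injective_resolution M) (i : nat) :
  finitely_generated (sub_graded (Qpart (local_cohomology I E i))).
Proof. exact: local_cohomology_Qpart_fg. Qed.
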